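(* Let $f:J\to\mathbb{R}^{n+1}$ be a regular curve with speed $\nu$ and Frenet apparatus $\{\kappa_1,\dots,\kappa_n,V_1,\dots,V_{n+1}\}$, let $I=[a,b]\subset J$, and let $S\subset\mathbb{R}^n$ be a compact set with $\mathrm{vol}\,S>0$ and barycenter $\tilde P=(p_1,\dots,p_n)$. Define $G:\mathbb{R}^n\times J\to\mathbb{R}^{n+1}$ by $$G(x_1,\dots,x_n,t)=f(t)+\sum_{j=1}^n(x_j-p_j)V_{j+1}(t).$$ Let $0<R<\rho$, where $\rho=1/\sup_J\kappa_1(t)$, and let $B(\tilde P,R)$ be the open ball of radius $R$ centered at $\tilde P$ in $\mathbb{R}^n$. Suppose that $S\subset B(\tilde P,R)$ and that $G$ is injective on $B(\tilde P,R)\times J$. Let $\Gamma=G(S\times I)$ be the tube around $f$ with constant cross section $S$ and axis passing through the barycenter of $S$. Then $$\mathrm{vol}\,\Gamma=l(f,I)\,\mathrm{vol}\,S,$$ where $l(f,I)=\int_a^b\nu(t)\,dt$ is the length of $f$ from $t=a$ to $t=b$. In other words, the volume of the tube is the product of the length of the curve traveled by the barycenter of $S$ and the volume of the cross section $S$.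
   Context: Curves are smooth maps on an interval $J$; $\nu=\|f'\|>0$. The Frenet apparatus of $f:J\to\mathbb{R}^{n+1}$ consists of an orthonormal frame field $V_1,\dots,V_{n+1}$ along $f$ with $V_1=f'/\nu$ and curvature functions $\kappa_1,\dots,\kappa_n$ satisfying the Frenet equations $V_1'=\kappa_1\nu V_2$, $V_j'=-\kappa_{j-1}\nu V_{j-1}+\kappa_j\nu V_{j+1}$ ($2\le j\le n$), $V_{n+1}'=-\kappa_n\nu V_n$. If $f$ is $n$-regular (i.e. $f',\dots,f^{(n)}$ are linearly independent everywhere) it is the usual one: the frame is positively oriented, $\mathrm{span}\{V_1,\dots,V_j\}=\mathrm{span}\{f',\dots,f^{(j)}\}$ for $j\le n$ and $\kappa_j>0$ for $j<n$. For suitable curves lying in an affine subspace of dimension $m<n+1$ (including straight lines) the apparatus is the one inside this subspace, completed by a constant orthonormal basis $V_{m+1},\dots,V_{n+1}$ of the orthogonal complement and $\kappa_m=\dots=\kappa_n=0$. If $\sup_J\kappa_1=0$, then $\rho=\infty$. The barycenter of a compact set $S\subset\mathbb{R}^n$ with $\mathrm{vol}\,S>0$ is the point $(c_1,\dots,c_n)$ with $c_j=\frac{1}{\mathrm{vol}\,S}\int_S x_j\,dx_1\cdots dx_n$. Volumes of $\Gamma$ and $S$ are Lebesgue measures in $\mathbb{R}^{n+1}$ and $\mathbb{R}^n$ respectively. *)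

(* Defs.v *)
From HB Require Import structures.
From mathcomp Require Import all_boot all_order all_algebra.
From mathcomp Require Import all_classical all_reals all_analysis.

Set Implicit Arguments.
Unset Strict Implicit.
Unset Printing Implicit Defensive.
Import Order.TTheory GRing.Theory Num.Theory.
Import numFieldNormedType.Exports.

Local Open Scope classical_set_scope.
Local Open Scope ring_scope.

Section measurable_rV.
Context {R : realType} {n : nat}.

Let coord (i : 'I_n) (x : 'rV[R]_n) : R := x 0 i.

Let rV_set0 : g_sigma_preimage coord set0.
Proof. exact: sigma_algebra0. Qed.

Let rV_setC A : g_sigma_preimage coord A -> g_sigma_preimage coord (~` A).
Proof. exact: sigma_algebraC. Qed.

Let rV_bigcup (F : (set 'rV[R]_n)^nat) :
  (forall i, g_sigma_preimage coord (F i)) ->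
  g_sigma_preimage coord (\bigcup_i (F i)).
Proof. exact: sigma_algebra_bigcup. Qed.

(* The sigma-algebra generated by the coordinates, which on R^n is the Borel
   one. *)
HB.instance Definition _ := @isMeasurable.Build default_measure_display
  'rV[R]_n (g_sigma_preimage coord) rV_set0 rV_setC rV_bigcup.

Lemma measurable_coord (i : 'I_n) :
  measurable_fun [set: 'rV[R]_n] (fun x => x 0 i : R).
Proof.
move=> _ Y mY; rewrite setTI; apply: sub_sigma_algebra => /=.
rewrite -bigcup_seq/=; exists i => /=; first by rewrite mem_index_enum.
by exists Y => //; rewrite setTI.
Qed.

Lemma measurable_fun_coordP d (T : measurableType d) (f : T -> 'rV[R]_n) :
  (forall i, measurable_fun [set: T] (fun x => f x 0 i : R)) ->
  measurable_fun [set: T] f.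
Proof.
move=> mf.
suff H : g_sigma_preimage (fun i => coord i \o f) `<=` measurable.
  move=> _ A mA; rewrite setTI; apply: H.
  by rewrite g_sigma_preimage_comp; exists A => //; rewrite setTI.
apply: smallest_sub; first exact: sigma_algebra_measurable.
rewrite -bigcup_seq/=; apply: bigcup_sub => i _.
by move=> A [B mB <-]; exact: mf.
Qed.

End measurable_rV.

Section lebesgue_rV.
Context {R : realType}.

Definition rV_cons n (z : measurableTypeR R * 'rV[R]_n) : 'rV[R]_n.+1 :=
  row_mx (z.1)%:M z.2 : 'rV[R]_(1 + n).

Definition rV_uncons n (x : 'rV[R]_n.+1) : measurableTypeR R * 'rV[R]_n :=
  (lsubmx (x : 'rV[R]_(1 + n)) 0 0, rsubmx (x : 'rV[R]_(1 + n))).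

Lemma rV_consK n : cancel (@rV_cons n) (@rV_uncons n).
Proof.
by move=> [a x]; rewrite /rV_uncons /rV_cons row_mxKl row_mxKr mxE eqxx mulr1n.
Qed.

Lemma measurable_rV_cons n : measurable_fun setT (@rV_cons n).
Proof.
apply: measurable_fun_coordP => i.
case: (split_ordP (i : 'I_(1 + n))) => j ->.
- rewrite (_ : (fun x => _) = fst); first exact: measurable_fst.
  apply/funext => -[c x] /=; apply: etrans (row_mxEl _ _ _ _) _.
  by rewrite ord1 mxE eqxx mulr1n.
- rewrite (_ : (fun x => _) = (fun x : 'rV[R]_n => x 0 j : R) \o snd).
    by apply: measurableT_comp; [exact: measurable_coord|exact: measurable_snd].
  by apply/funext => -[c x] /=; exact: (row_mxEr c%:M x 0 j).
Qed.

Lemma measurable_rV_uncons n : measurable_fun setT (@rV_uncons n).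
Proof.
apply: measurable_fun_pair => /=.
- rewrite (_ : (fun x => _) = fun x : 'rV[R]_n.+1 => x 0 ord0 : R).
    exact: measurable_coord.
  by apply/funext => x; rewrite mxE; congr (x _ _); apply/val_inj.
- apply: measurable_fun_coordP => i.
  rewrite (_ : (fun x => _) = fun x : 'rV[R]_n.+1 => x 0 (rshift 1 i) : R).
    exact: measurable_coord.
  by apply/funext => x; rewrite mxE.
Qed.

Section step.
Variables (n : nat) (mu : {sigma_finite_measure set 'rV[R]_n -> \bar R}).

Definition lebesgue_step : set 'rV[R]_n.+1 -> \bar R :=
  pushforward (lebesgue_measure \x mu)%E (@rV_cons n).

HB.instance Definition _ := Measure.copy lebesgue_step
  (measure_function_pushforward__canonical__measure_function_Measure
    (lebesgue_measure \x mu)%E (@measurable_rV_cons n)).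

Let lebesgue_step_sigma_finite : sigma_finite setT lebesgue_step.
Proof.
have /sigma_finiteP[F [TF ndF Foo]] := sigma_finiteT (@lebesgue_measure R).
have /sigma_finiteP[G [TG ndG Goo]] := sigma_finiteT mu.
exists (fun k => @rV_uncons n @^-1` (F k `*` G k)).
  rewrite -preimage_bigcup (_ : \bigcup_k _ = setT) ?preimage_setT//.
  rewrite -setXTT TF TG predeqE => -[x y]; split.
    by move=> [k _ []/= ? ?]; split; exists k.
  move=> [/= [k _ Fkx] [l _ Gly]]; exists (maxn k l) => //; split.
  - by move: x Fkx; exact/subsetPset/ndF/leq_maxl.
  - by move: y Gly; exact/subsetPset/ndG/leq_maxr.
move=> k; have [mF Fk] := Foo k; have [mG Gk] := Goo k; split.
  rewrite -[X in measurable X]setTI; apply: measurable_rV_uncons => //.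
  exact: measurableX.
rewrite /lebesgue_step /pushforward -comp_preimage.
rewrite (_ : _ \o _ = id); last by apply/funext => z /=; rewrite rV_consK.
by rewrite preimage_id product_measure1E// lte_mul_pinfty// ge0_fin_numE.
Qed.

HB.instance Definition _ := @Measure_isSigmaFinite.Build _ _ _
  lebesgue_step lebesgue_step_sigma_finite.

End step.

(* Lebesgue measure on R^n (on Borel sets), as the n-fold product of the
   Lebesgue measure of the line. *)
Fixpoint lebesgue_rV (n : nat) :
    {sigma_finite_measure set 'rV[R]_n -> \bar R} :=
  match n with
  | 0 => \d_(0 : 'rV[R]_0)
  | n'.+1 => lebesgue_step (lebesgue_rV n')
  end.


Lemma lebesgue_rV_box n (A : 'I_n -> set R) :
  (forall i, measurable (A i)) ->
  lebesgue_rV n [set x | forall i, A i (x 0 i)] =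
  (\prod_(i < n) lebesgue_measure (A i))%E.
Proof.
elim: n A => [|n IHn] A mA.
  rewrite big_ord0 (_ : (fun _ => _) = setT); first by rewrite /= diracT.
  by apply/seteqP; split => // x _ [].
rewrite big_ord_recl -IHn// -product_measure1E; last 2 first.
- exact: mA.
- rewrite (_ : (fun _ => _) = \bigcap_(i in [set: 'I_n])
      ((fun x : 'rV[R]_n => x 0 i : R) @^-1` A (lift ord0 i))).
    apply: fin_bigcap_measurable => [|i _]; first exact: finite_finset.
    by rewrite -[X in measurable X]setTI; exact: measurable_coord.
  by apply/seteqP; split => [x /= H i _|x /= H i]; exact: H.
rewrite /= /lebesgue_step /pushforward; congr ((_ \x _)%E _).
have cE c (x : 'rV[R]_n) i : rV_cons (c, x) 0 i =
    if unlift ord0 i is Some j then x 0 j else c.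
  case: (unliftP ord0 i) => [j|] -> /=.
    have -> : lift ord0 j = rshift 1 j by apply/val_inj.
    exact: (row_mxEr c%:M x 0 j).
  have -> : ord0 = lshift n (@ord0 0) by apply/val_inj.
  by apply: etrans (row_mxEl _ _ _ _) _; rewrite mxE eqxx mulr1n.
apply/seteqP; split => -[c x] /= H.
- split=> [|i]; first by have := H ord0; rewrite cE unlift_none.
  by have := H (lift ord0 i); rewrite cE liftK.
- move=> i; rewrite cE.
  by case: (unliftP ord0 i) => [j|] ->; [exact: H.2|exact: H.1].
Qed.

End lebesgue_rV.

(* The library norm on 'rV[R]_n is the sup norm. *)
Section euclidean.
Context {R : realType} {n : nat}.

Definition dotv (u v : 'rV[R]_n) : R := \sum_(i < n) u 0 i * v 0 i.

Definition enorm (u : 'rV[R]_n) : R := Num.sqrt (dotv u u).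

Definition eball (p : 'rV[R]_n) (r : R) : set 'rV[R]_n :=
  [set x | enorm (x - p) < r].

Definition barycenter (S : set 'rV[R]_n) : 'rV[R]_n :=
  \row_j ((fine (lebesgue_rV n S))^-1 * \int[lebesgue_rV n]_(x in S) x 0 j).

End euclidean.

(* Derivatives of functions defined on an interval J, which need not be open:
   the limit is taken inside J, so it is one-sided at an endpoint of J. *)
Section derivatives_on.
Context {R : realType} {W : normedModType R}.

Definition derive_on (J : set R) (g : R -> W) (t : R) : W :=
  lim ((s - t)^-1 *: (g s - g t) @[s --> within J t^']).

Definition derive_on_n (J : set R) (k : nat) (g : R -> W) : R -> W :=
  iter k (derive_on J) g.

Definition smooth_on (J : set R) (g : R -> W) : Prop :=
  forall k t, J t ->
  cvg ((s - t)^-1 *: (derive_on_n J k g s - derive_on_n J k g t)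
       @[s --> within J t^']).

End derivatives_on.

Section curves.
Context {R : realType} {n : nat}.
Variables (J : set R) (f : R -> 'rV[R]_n.+1).

Definition speed (t : R) : R := enorm (derive_on J f t).

Definition regular_curve : Prop :=
  smooth_on J f /\ forall t, J t -> 0 < speed t.

Definition arc_length (a b : R) : \bar R :=
  (\int[lebesgue_measure]_(t in `[a, b]) (speed t)%:E)%E.

(* Rows f', ..., f^(k). *)
Definition jet (k : nat) (t : R) : 'M[R]_(k, n.+1) :=
  \matrix_(i < k) derive_on_n J i.+1 f t.

Definition regular_upto (k : nat) : Prop :=
  forall t, J t -> row_free (jet k t).

(* Indices start at 1: only V 1, ..., V n.+1 and kappa 1, ..., kappa n are
   meaningful. *)
Implicit Types (kappa : nat -> R -> R) (V : nat -> R -> 'rV[R]_n.+1).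

Definition frame_mx V (k : nat) (t : R) : 'M[R]_(k, n.+1) :=
  \matrix_(i < k) V i.+1 t.

Definition frame_field V : Prop :=
  (forall j, (1 <= j <= n.+1)%N -> smooth_on J (V j)) /\
  (forall t, J t -> forall i j, (1 <= i <= n.+1)%N -> (1 <= j <= n.+1)%N ->
     dotv (V i t) (V j t) = (i == j)%:R).

Definition frenet_equations kappa V : Prop :=
  forall t, J t ->
  [/\ derive_on J (V 1) t = (kappa 1 t * speed t) *: V 2 t,
      forall j, (2 <= j <= n)%N ->
        derive_on J (V j) t = - (kappa j.-1 t * speed t) *: V j.-1 t
                              + (kappa j t * speed t) *: V j.+1 t
    & derive_on J (V n.+1) t = - (kappa n t * speed t) *: V n t].

Definition frenet_normalized kappa V : Prop :=
  forall t, J t ->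
  [/\ 0 < \det (frame_mx V n.+1 t),
      forall j, (j <= n)%N -> (frame_mx V j t :=: jet j t)%MS
    & forall j, (1 <= j < n)%N -> 0 < kappa j t].

(* The frame of a curve in a proper affine subspace, completed by constant
   vectors with vanishing curvatures, is among those allowed when the curve is
   not n-regular. *)
Definition frenet_apparatus kappa V : Prop :=
  [/\ frame_field V,
      forall t, J t -> V 1 t = (speed t)^-1 *: derive_on J f t,
      frenet_equations kappa V
    & regular_upto n -> frenet_normalized kappa V].

(* Inverting in \bar R gives rho = +oo when sup kappa_1 = 0, and rho = 0 when
   kappa_1 is unbounded above. *)
Definition frenet_radius kappa : \bar R :=
  (ereal_sup [set (kappa 1 t)%:E | t in J])^-1%E.

(* Coordinates of x and p are numbered from 0, those of V from 1: the j-th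
   coordinate of x goes with V j.+2. *)
Definition tube_map V (p : 'rV[R]_n) (z : 'rV[R]_n * R) : 'rV[R]_n.+1 :=
  f z.2 + \sum_(j < n) (z.1 0 j - p 0 j) *: V j.+2 z.2.

Definition tube V (p : 'rV[R]_n) (S : set 'rV[R]_n) (I : set R) :=
  tube_map V p @` (S `*` I).

End curves.

(* Main.v *)
Require Import Defs.
From HB Require Import structures.
From mathcomp Require Import all_boot all_order all_algebra.
From mathcomp Require Import all_classical all_reals all_analysis.
From mathcomp Require Import measurable_realfun ring lra.

Set Implicit Arguments.
Unset Strict Implicit.
Unset Printing Implicit Defensive.
Import Order.TTheory GRing.Theory Num.Theory.
Import numFieldNormedType.Exports.

Local Open Scope classical_set_scope.
Local Open Scope ring_scope.

(** The tube map [G (x, t) = f t + \sum_j (x_j - p_j) V_(j+1)(t)] has Jacobian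
    [jac t x = nu t - th t * (x_1 - p_1)], where [nu] is the speed and
    [th = kappa_1 nu]: differentiating in [t], only the component along [V_1]
    counts, and it sees the frame through [V_1' = th V_2] alone.  Hence the
    volume over a cross section [A] should be [L vol A - H mom A], where [L] is
    the length, [H] the integral of [th] and [mom A] the integral of
    [x_1 - p_1] over [A]; and [mom S = 0] when [p] is the barycenter of [S].

    The formula is obtained by differentiating the volume in [t], with no
    general change of variables.  Take the frame at an instant [t0] as
    orthonormal coordinates, which is allowed because Lebesgue measure is
    invariant under translations and rotations ([lebesgue_rV_shift],
    [lebesgue_rV_mulmx]).  The normal hyperplane of a nearby instant [t] is then
    the graph of a function which is [jac t0 * (t - t0)] at first order
    ([hgt_estimate]), so a short piece of the tube is nearly the region
    between two such graphs, whose volume is given by Fubini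
    ([lebesgue_rV_region]).  Near the boundary of the cross section the frame at
    [t] and the frame at [t0] disagree; this costs nothing if one
    is content with an upper bound when the section is compact, which may then
    be thickened ([tube_upper_local]), and with a lower bound when it is open,
    which may then be shrunk ([tube_lower_local]).  Both bounds add up along
    [[a, b]] ([itv_local_ind], [tube_upper], [tube_lower]).

    One-sided bounds suffice ([tube_volume]): if [O] is the ball, then
    [O \ S] is an increasing union of compact sets, so the upper bound holds for
    it as well as for [S]; their sum is the lower bound for [O], and there is no
    room left.

    The graph of a later instant must lie above that of an earlier one, that is
    [jac >= 0] on the ball.  This is a consequence of injectivity: a change of
    sign of [jac] is a focal point, past which nearby normal hyperplanes meet
    ([jac_ge0]). *)

(** * Translation invariance of Lebesgue measure *)

Section translation.
Context {R : realType}.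

Lemma lebesgue_measure_shift (c : R) (A : set (measurableTypeR R)) :
  measurable A -> lebesgue_measure ((fun x => x + c) @^-1` A) = lebesgue_measure A.
Proof.
move=> mA.
have mc : measurable_fun [set: measurableTypeR R]
    ((fun x => x + c) : measurableTypeR R -> measurableTypeR R).
  exact: measurable_funD.
rewrite -[LHS]/(pushforward lebesgue_measure _ A).
apply/esym.
have := @lebesgue_measure_unique R (measure_function_pushforward__canonical__measure_function_Measure
   (@lebesgue_measure R) mc).
apply => // X [[x1 x2] _ <-] /=; rewrite /pushforward.
rewrite (_ : _ @^-1` _ = `]x1 - c, x2 - c]%classic); last first.
  by apply/seteqP; split => x /=; rewrite !in_itv /= ltrBlDr lerBrDr.
rewrite !lebesgue_measure_itv/= !lte_fin ltrD2r.
by case: ifP => // _; rewrite -!EFinB; congr EFin; lra.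
Qed.

Lemma measurable_shift n (v : 'rV[R]_n) :
  measurable_fun [set: 'rV[R]_n] (fun x => x + v).
Proof.
apply: measurable_fun_coordP => i.
rewrite (_ : (fun x => _) = (fun x : 'rV[R]_n => x 0 i + v 0 i)); last first.
  by apply/funext => x; rewrite mxE.
by apply: measurable_funD => //; exact: measurable_coord.
Qed.

Lemma rV_cons0E n (z : measurableTypeR R * 'rV[R]_n) : rV_cons z 0 ord0 = z.1.
Proof.
have -> : ord0 = lshift n (@ord0 0) by apply/val_inj.
by apply: etrans (row_mxEl _ _ _ _) _; rewrite mxE eqxx mulr1n.
Qed.

Lemma rV_consSE n (z : measurableTypeR R * 'rV[R]_n) (j : 'I_n) :
  rV_cons z 0 (lift ord0 j) = z.2 0 j.
Proof.
have -> : lift ord0 j = rshift 1 j by apply/val_inj.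
exact: (row_mxEr z.1%:M z.2 0 j).
Qed.

Lemma rV_consD n (z w : measurableTypeR R * 'rV[R]_n) :
  rV_cons (z.1 + w.1, z.2 + w.2) = rV_cons z + rV_cons w.
Proof.
apply/rowP => i; rewrite [in RHS]mxE.
by case: (unliftP ord0 i) => [j|] ->; rewrite ?rV_cons0E ?rV_consSE// mxE.
Qed.

Lemma rV_unconsK n : cancel (@rV_uncons R n) (@rV_cons R n).
Proof.
move=> x; apply/rowP => i.
by case: (unliftP ord0 i) => [j|] ->; rewrite ?rV_cons0E ?rV_consSE/= !mxE;
  congr (x _ _); apply/val_inj.
Qed.

Lemma lebesgue_rV_shift n (v : 'rV[R]_n) (A : set 'rV[R]_n) :
  measurable A -> lebesgue_rV n ((fun x => x + v) @^-1` A) = lebesgue_rV n A.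
Proof.
elim: n v A => [|n IHn] v A mA.
  by rewrite (_ : (fun x => _) = id)//; apply/funext => x; apply/rowP => -[].
pose c := (rV_uncons v).1; pose w := (rV_uncons v).2.
pose T := (fun z : measurableTypeR R * 'rV[R]_n =>
  (z.1 + c, z.2 + w) : measurableTypeR R * 'rV[R]_n).
have mT : measurable_fun setT T.
  apply: measurable_fun_pair.
    by apply: (@measurable_funD _ _ _ _ (fun z : measurableTypeR R * 'rV[R]_n => (z.1 : R)));
     [exact: measurable_fst|exact: measurable_cst].
  by apply: (measurableT_comp (measurable_shift w)); exact: measurable_snd.
rewrite /= /lebesgue_step /pushforward.
have mcA : measurable (@rV_cons R n @^-1` A).
  by rewrite -[X in measurable X]setTI; exact: measurable_rV_cons.
rewrite (_ : _ @^-1` (_ @^-1` A) = T @^-1` (@rV_cons R n @^-1` A)); last first.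
  by apply/seteqP; split => z /=; rewrite -[v](rV_unconsK) /T rV_consD.
apply/esym.
have := @product_measure_unique _ _ _ _ _ (@lebesgue_measure R) (lebesgue_rV n)
  (measure_function_pushforward__canonical__measure_function_Measure
   (lebesgue_measure \x lebesgue_rV n)%E mT).
apply => // X Y mX mY; rewrite /= /pushforward.
rewrite (_ : T @^-1` _ = ((fun x => x + c) @^-1` X) `*` ((fun x => x + w) @^-1` Y))//.
rewrite product_measure1E.
- by congr (_ * _)%E; [exact: lebesgue_measure_shift|exact: IHn].
- rewrite -[X in measurable X]setTI.
  have mc : measurable_fun [set: measurableTypeR R]
    ((fun x => x + c) : measurableTypeR R -> measurableTypeR R).
    exact: measurable_funD.
  exact: mc.
- by rewrite -[X in measurable X]setTI; exact: measurable_shift.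
Qed.

End translation.

(** * Borel sets and compact exhaustions *)

Section topology_rV.
Context {R : realType} {n : nat}.
Implicit Types (x y : 'rV[R]_n) (U K : set 'rV[R]_n).

Lemma ball_rVE x (e : R) : 0 < e ->
  ball x e = [set y | forall i, `|x 0 i - y 0 i| < e].
Proof.
move=> e0; apply/seteqP; split => y /=; first by case => _ H i; exact: H.
by move=> H; split=> // i j; rewrite [i]ord1; exact: H.
Qed.

Lemma measurable_box (A : 'I_n -> set R) : (forall i, measurable (A i)) ->
  measurable [set x : 'rV[R]_n | forall i, A i (x 0 i)].
Proof.
move=> mA; rewrite (_ : [set x | _] = \bigcap_(i in [set: 'I_n])
    ((fun x : 'rV[R]_n => x 0 i : R) @^-1` (A i))); last first.
  by apply/seteqP; split => [x /= H i _|x /= H i]; exact: H.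
apply: fin_bigcap_measurable => [|i _]; first exact: finite_finset.
by rewrite -[X in measurable X]setTI; apply: measurable_coord.
Qed.

(** An open set is the union of the countably many open cubes that it contains
    with rational centre and radius [1 / k]. *)
Lemma measurable_open_rV U : open U -> measurable U.
Proof.
move=> oU.
pose B (qk : 'rV[rat]_n * nat) := [set y : 'rV[R]_n | forall i,
  `|y 0 i - ratr (qk.1 0 i)| < qk.2.+1%:R^-1].
pose F qk := if `[< B qk `<=` U >] then B qk else set0.
suff -> : U = \bigcup_qk F qk.
  apply: countable_bigcupT_measurable; first exact: countableP.
  move=> qk; rewrite /F; case: asboolP => // _.
  apply: (measurable_box (A := fun i =>
    [set z : R | `|z - ratr (qk.1 0 i)| < qk.2.+1%:R^-1])) => i.
  rewrite (_ : [set z | _] = `]ratr (qk.1 0 i) - qk.2.+1%:R^-1,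
                     ratr (qk.1 0 i) + qk.2.+1%:R^-1[%classic) //.
  by apply/seteqP; split => z /=; rewrite in_itv /= ltr_distl.
apply/seteqP; split => [x Ux|x [qk _]]; last first.
  by rewrite /F; case: asboolP => // BU; exact: BU.
have /nbhs_ballP[e /= e0 xeU] : nbhs x U by move: oU; rewrite openE => /(_ _ Ux).
have [k ke] : exists k, k.+1%:R^-1 < e / 2.
  have [|k] := @ltr_add_invr R 0 (e / 2); first by rewrite divr_gt0.
  by rewrite add0r => ke; exists k.
have k0 : 0 < k.+1%:R^-1 :> R by rewrite invr_gt0.
have /choice[q qP] : forall i, exists q : rat, `|x 0 i - ratr q| < k.+1%:R^-1.
  move=> i; have [|q] := @rat_in_itvoo R (x 0 i - k.+1%:R^-1) (x 0 i + k.+1%:R^-1).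
    by rewrite ltrD2l (lt_trans _ k0)// oppr_lt0.
  by rewrite in_itv /= => xq; exists q; rewrite distrC ltr_distl.
exists (\row_i q i, k) => //; rewrite /F; case: asboolP => [_|[]].
  by move=> i /=; rewrite mxE.
move=> y By; apply: xeU; rewrite ball_rVE// => i.
have := By i; have := qP i; rewrite /= mxE => h1 h2.
rewrite (_ : x 0 i - y 0 i = (x 0 i - ratr (q i)) - (y 0 i - ratr (q i))); last by lra.
by rewrite (le_lt_trans (ler_normB _ _))// [ltRHS]splitr ltrD// (lt_trans _ ke).
Qed.

Lemma measurable_compact_rV K : compact K -> measurable K.
Proof.
move=> cK; rewrite -[K]setCK; apply: measurableC; apply: measurable_open_rV.
by rewrite openC; apply: compact_closed => //; exact: norm_hausdorff.
Qed.

(** The points of norm at most [k] which are no closer than [1 / k] to the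
    complement form a closed bounded set. *)
Lemma open_exhaustion U : open U ->
  exists K : nat -> set 'rV[R]_n,
  [/\ forall k, compact (K k), nondecreasing_seq K & U = \bigcup_k K k].
Proof.
move=> oU.
pose K (k : nat) := [set x : 'rV[R]_n | `|x| <= k%:R /\
   forall y, ball y k.+1%:R^-1 x -> U y].
have k0 k : 0 < k.+1%:R^-1 :> R by rewrite invr_gt0.
exists K; split.
- move=> k; apply: bounded_closed_compact.
    exists k%:R; split; first by rewrite num_real.
    by move=> M kM x [xk _]; exact: le_trans xk (ltW kM).
  rewrite (_ : K k = (fun x : 'rV[R]_n => `|x|) @^-1` [set r | r <= k%:R] `&`
      ~` (\bigcup_(y in ~` U) ball y k.+1%:R^-1)); last first.
    apply/seteqP; split => [x [xk H]|x [xk H]].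
      by split => // -[y Uy xy]; apply: Uy; exact: H.
    split => // y xy; apply: contrapT => Uy; apply: H; by exists y.
  apply: closedI.
    apply: closed_comp; last exact: closed_le.
    by move=> x _; exact: norm_continuous.
  by rewrite closedC; apply: bigcup_open => y _; exact: ball_open.
- move=> k l kl; apply/subsetPset => x [xk H]; split.
    by rewrite (le_trans xk)// ler_nat.
  move=> y yx; apply: H; apply: le_ball yx.
  by rewrite lef_pV2 ?posrE ?ler_nat.
- apply/seteqP; split => [x Ux|x [k _ [_ H]]]; last first.
    by apply: H; exact: ballxx.
  have /nbhs_ballP[e /= e0 xeU] : nbhs x U by move: oU; rewrite openE => /(_ _ Ux).
  have [k ke] : exists k, k.+1%:R^-1 < e.
    have [k] := @ltr_add_invr R 0 e e0.
    by rewrite add0r => ke; exists k.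
  exists (maxn k (Num.truncn `|x|).+1) => //; split.
    apply: (le_trans (ltW (truncnS_gt `|x|))).
    by rewrite ler_nat leq_maxr.
  move=> y yx; apply: xeU; apply: ball_sym; apply: le_ball yx.
  apply: le_trans (ltW ke).
  by rewrite lef_pV2 ?posrE// ler_nat ltnS leq_maxl.
Qed.

Lemma compact_thickening K U : compact K -> open U -> K `<=` U ->
  exists2 e : R, 0 < e & forall x y, K x -> `|x - y| < e -> U y.
Proof.
move=> /compact_near_coveringP cK oU KU.
have H : \forall e \near (0 : R)^'+, K `<=` (fun x => forall y, `|x - y| < e -> U y).
  apply: (cK R (0^'+) (fun e x => forall y, `|x - y| < e -> U y)) => x Kx.
  have /nbhs_ballP[e /= e0 xeU] : nbhs x U.
    by move: oU; rewrite openE; apply; exact: KU.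
  near=> x' d => /= y x'y; apply: xeU; rewrite -ball_normE /=.
  rewrite (_ : x - y = (x - x') + (x' - y)); last by rewrite addrA subrK.
  rewrite (le_lt_trans (ler_normD _ _))// [ltRHS](splitr e) ltrD//.
    by near: x'; apply: cvgr_dist_lt; rewrite ?divr_gt0.
  by rewrite (lt_trans x'y)//; near: d; apply: nbhs_right_lt; rewrite divr_gt0.
near (0 : R)^'+ => e; exists e => //.
by have /= := near H e _; move=> He x y Kx; apply: He.
Unshelve. all: by end_near.
Qed.

End topology_rV.

(** * Euclidean norm and rotation invariance *)

Section fubini_sets.
Context d1 d2 (T1 : measurableType d1) (T2 : measurableType d2) (R : realType).
Variables (m1 : {sigma_finite_measure set T1 -> \bar R})
          (m2 : {sigma_finite_measure set T2 -> \bar R}).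

Lemma product_measure_xsection (X : set (T1 * T2)) : measurable X ->
  (m1 \x m2)%E X = (\int[m1]_x m2 [set y | X (x, y)])%E.
Proof.
move=> mX; apply: eq_integral => x _; congr (m2 _).
by apply/seteqP; split => y /xsectionP.
Qed.

(** The two orders of integration define measures that agree on rectangles. *)
Lemma product_measure_ysection (X : set (T1 * T2)) : measurable X ->
  (m1 \x m2)%E X = (\int[m2]_y m1 [set x | X (x, y)])%E.
Proof.
move=> mX; transitivity ((m1 \x^ m2)%E X).
  by apply: product_measure_unique => //= ? ? ? ?; rewrite product_measure2E.
apply: eq_integral => y _; congr (m1 _).
by apply/seteqP; split => x /ysectionP.
Qed.

End fubini_sets.

Section dotv_theory.
Context {R : realType} {n : nat}.
Implicit Types (u v w : 'rV[R]_n).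

Lemma dotvC u v : dotv u v = dotv v u.
Proof. by apply: eq_bigr => i _; rewrite mulrC. Qed.

Lemma dotv_mx u v : dotv u v = (u *m v^T) 0 0.
Proof. by rewrite mxE; apply: eq_bigr => i _; rewrite mxE. Qed.

Lemma dotvDl u v w : dotv (u + v) w = dotv u w + dotv v w.
Proof. by rewrite !dotv_mx mulmxDl mxE. Qed.

Lemma dotvBl u v w : dotv (u - v) w = dotv u w - dotv v w.
Proof. by rewrite !dotv_mx mulmxBl !mxE. Qed.

Lemma dotvZl a u w : dotv (a *: u) w = a * dotv u w.
Proof. by rewrite !dotv_mx -scalemxAl mxE. Qed.

Lemma dotvBr u v w : dotv w (u - v) = dotv w u - dotv w v.
Proof. by rewrite !(dotvC w) dotvBl. Qed.

Lemma dotvZr a u w : dotv w (a *: u) = a * dotv w u.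
Proof. by rewrite !(dotvC w) dotvZl. Qed.

Lemma entry_le_enorm u i : `|u 0 i| <= enorm u.
Proof.
rewrite -sqrtr_sqr ler_wsqrtr// /dotv (bigD1 i)//= -expr2 lerDl.
by apply: sumr_ge0 => j _; rewrite -expr2 sqr_ge0.
Qed.

Lemma enormZ a u : enorm (a *: u) = `|a| * enorm u.
Proof.
rewrite /enorm dotvZl dotvZr mulrA -expr2 sqrtrM ?sqr_ge0//.
by rewrite sqrtr_sqr.
Qed.

Lemma enormN u : enorm (- u) = enorm u.
Proof. by rewrite -scaleN1r enormZ normrN1 mul1r. Qed.

Lemma dotv_mulmx (M : 'M[R]_n) u v : M *m M^T = 1%:M ->
  dotv (u *m M) (v *m M) = dotv u v.
Proof. by move=> MM; rewrite !dotv_mx trmx_mul mulmxA -(mulmxA u) MM mulmx1. Qed.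

Lemma cvg_dotv (T : Type) (F : set_system T) {FF : Filter F}
    (f g : T -> 'rV[R]_n) u v :
  f @ F --> u -> g @ F --> v -> dotv (f x) (g x) @[x --> F] --> dotv u v.
Proof.
move=> fu gv; rewrite /dotv.
elim: (index_enum _) => [|i s IHs].
  by rewrite !big_nil; under eq_cvg do rewrite big_nil; exact: cvg_cst.
rewrite big_cons; under eq_cvg do rewrite big_cons.
have cc (h : T -> 'rV[R]_n) w : h @ F --> w -> h x 0 i @[x --> F] --> w 0 i.
  move=> hw; apply: (cvg_comp h (fun w : 'rV[R]_n => w 0 i)); first exact: hw.
  exact: coord_continuous.
by apply: cvgD => //; apply: cvgM; exact: cc.
Qed.

Lemma enorm_continuous : continuous (@enorm R n).
Proof.
move=> u; apply: (@continuous_comp _ _ _ (fun u => dotv u u) Num.sqrt).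
  by apply: (@cvg_dotv _ (nbhs u) _ id id); exact: cvg_id.
exact: sqrt_continuous.
Qed.

Lemma open_eball u (r : R) : open (eball u r).
Proof.
rewrite (_ : eball u r = (fun x => enorm (x - u)) @^-1` [set z | z < r])//.
have cB : continuous (fun x : 'rV[R]_n => x - u).
  by move=> x; apply: (@cvgB _ _ _ (nbhs x) _ id (cst u)); [exact: cvg_id|exact: cvg_cst].
apply: open_comp; last exact: open_lt.
by move=> x _; apply: (continuous_comp (cB x)); exact: enorm_continuous.
Qed.

End dotv_theory.

Section eball_finite.
Context {R : realType} {n : nat}.
Implicit Types (p : 'rV[R]_n) (r : R).

Lemma measurable_eball p r : measurable (eball p r).
Proof. by apply: measurable_open_rV; exact: open_eball. Qed.

Lemma lebesgue_rV_eball_fin p r : (lebesgue_rV n (eball p r) < +oo)%E.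
Proof.
pose C i := `[p 0 i - r, p 0 i + r]%classic.
apply: (@le_lt_trans _ _ (lebesgue_rV n [set x : 'rV[R]_n | forall i, C i (x 0 i)])).
  apply: le_measure; rewrite ?inE//; first exact: measurable_eball.
    by apply: measurable_box => i; exact: measurable_itv.
  move=> x xr i; rewrite /C /= in_itv/= -ler_distl.
  have := le_lt_trans (entry_le_enorm (x - p) i) xr.
  by rewrite !mxE => /ltW.
rewrite (lebesgue_rV_box (A := C)); last by move=> i; exact: measurable_itv.
rewrite ltey_eq prode_fin_num// => i _.
by rewrite lebesgue_measure_itv/=; case: ifP.
Qed.

End eball_finite.

Section rotation.
Context {R : realType} {n : nat}.

Lemma measurable_mulmx (M : 'M[R]_n) :
  measurable_fun [set: 'rV[R]_n] (fun x => x *m M).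
Proof.
apply: measurable_fun_coordP => i.
under eq_fun do rewrite mxE.
apply: (@measurable_sum _ _ R) => j.
by apply: measurable_funM => //; exact: measurable_coord.
Qed.

Lemma lebesgue_rV_unit_eball_gt0 :
  (0 < lebesgue_rV n (eball (0 : 'rV[R]_n) 1))%E.
Proof.
(* The cube of half-side [1 / (n + 1)] lies in the unit ball. *)
pose c : R := n.+1%:R^-1.
have c0 : 0 < c by rewrite invr_gt0.
pose C (i : 'I_n) := `[- c, c]%classic.
have mC i : measurable (C i) by exact: measurable_itv.
apply: (@lt_le_trans _ _
  (lebesgue_rV n [set x : 'rV[R]_n | forall i, C i (x 0 i)])).
  rewrite (lebesgue_rV_box mC).
  apply: (big_ind (fun x => 0 < x)%E) => // [x y|i _].
    exact: mule_gt0.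
  by rewrite lebesgue_measure_itv/= lte_fin ifT ?lte_fin; lra.
apply: le_measure; rewrite ?inE//.
- exact: measurable_box.
- exact: measurable_eball.
move=> x /= xc; rewrite /eball/= subr0 /enorm -[ltRHS]sqrtr1 ltr_sqrt//.
rewrite /dotv (@le_lt_trans _ _ (\sum_(i < n) c ^+ 2))//.
  apply: ler_sum => i _; have := xc i; rewrite /C /= in_itv /= -ler_norml => xic.
  by rewrite -expr2 -(real_normK (num_real (x 0 i))) lerXn2r ?nnegrE// ltW.
rewrite sumr_const card_ord -mulr_natl.
have nc : n.+1%:R * c = 1 by rewrite /c divff.
have Nc0 : 0 <= n%:R * c by rewrite mulr_ge0// ltW.
move: nc; rewrite -natr1 mulrDl mul1r => nc; rewrite expr2 mulrA.
have -> : n%:R * c = 1 - c by apply/eqP; rewrite eq_sym subr_eq nc.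
by nra.
Qed.

(** The usual uniqueness argument for Haar measure: multiplied by the volume of
    the unit ball [B], which is finite, positive and invariant under [M], both
    sides compute the volume of [{(x, y) | y M \in B, x + y M \in A}].  Fixing
    [y] and translating [x] gives [vol B * vol A]; fixing [x] and translating
    [y] by [- x M^-1] turns the set into [{(x, y) | y M - x \in B, y M \in A}],
    whose slices at fixed [y] are translates of [B]. *)
Lemma lebesgue_rV_mulmx (M : 'M[R]_n) (A : set 'rV[R]_n) :
  M *m M^T = 1%:M -> measurable A ->
  lebesgue_rV n ((fun x => x *m M) @^-1` A) = lebesgue_rV n A.
Proof.
move=> MM mA; pose B := eball (0 : 'rV[R]_n) 1.
pose phi (x : 'rV[R]_n) := x *m M.
have mphi := measurable_mulmx M.
have mB : measurable B by apply: measurable_open_rV; exact: open_eball.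
have mphiI D : measurable D -> measurable (phi @^-1` D).
  by move=> mD; rewrite -[X in measurable X]setTI; exact: mphi.
have phiB : phi @^-1` B = B.
  apply/seteqP; split => x; rewrite /B /eball /phi /= !subr0 /enorm;
  by rewrite dotv_mulmx.
have MM' : M^T *m M = 1%:M by exact: mulmx1C.
have phiK x : phi (x *m M^T) = x by rewrite /phi -mulmxA MM' mulmx1.
pose X1 := [set z : 'rV[R]_n * 'rV[R]_n | B (phi z.2) /\ A (z.1 + phi z.2)].
pose X2 := [set z : 'rV[R]_n * 'rV[R]_n | B (phi z.2 - z.1) /\ A (phi z.2)].
have mp2 : measurable_fun setT (fun z : 'rV[R]_n * 'rV[R]_n => phi z.2).
  by apply: (measurableT_comp mphi); exact: measurable_snd.
have mp2i i : measurable_fun setT (fun z : 'rV[R]_n * 'rV[R]_n => phi z.2 0 i).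
  by apply: (measurableT_comp (measurable_coord i)).
have m1i i : measurable_fun setT (fun z : 'rV[R]_n * 'rV[R]_n => z.1 0 i : R).
  by apply: (measurableT_comp (measurable_coord i)); exact: measurable_fst.
have mD : measurable_fun setT (fun z : 'rV[R]_n * 'rV[R]_n => z.1 + phi z.2).
  apply: measurable_fun_coordP => i; under eq_fun do rewrite mxE.
  exact: measurable_funD.
have mS : measurable_fun setT (fun z : 'rV[R]_n * 'rV[R]_n => phi z.2 - z.1).
  apply: measurable_fun_coordP => i.
  rewrite [X in measurable_fun _ X](_ : _ = fun z : 'rV[R]_n * 'rV[R]_n =>
      phi z.2 0 i - z.1 0 i).
    exact: measurable_funB.
  by apply/funext => z; rewrite [LHS]mxE; congr (_ + _); rewrite mxE.
have mX1 : measurable X1.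
  apply: measurableI.
    by rewrite -[X in measurable X]setTI; exact: mp2.
  by rewrite -[X in measurable X]setTI; exact: mD.
have mX2 : measurable X2.
  apply: measurableI.
    by rewrite -[X in measurable X]setTI; exact: mS.
  by rewrite -[X in measurable X]setTI; exact: mp2.
pose lam : {sigma_finite_measure set 'rV[R]_n -> \bar R} := lebesgue_rV n.
have int_indic (D : set 'rV[R]_n) (c : \bar R) : measurable D -> (0 <= c)%E ->
    (\int[lam]_y ((\1_D y)%:E * c) = lam D * c)%E.
  move=> mD' c0; rewrite ge0_integralZr//; last by apply/measurable_EFinP.
  by rewrite integral_indic// setIT.
have e1 : ((lam \x lam) X1 = lam B * lam A)%E.
  rewrite product_measure_ysection//.
  rewrite -[in RHS]phiB -int_indic//; last exact: mphiI.
  apply: eq_integral => y _; rewrite indicE.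
  have [/set_mem yB|/negP yB] := boolP (y \in phi @^-1` B).
    rewrite mul1e -[in RHS](lebesgue_rV_shift (phi y))//; congr (lam _).
    by apply/seteqP; split => x //= -[].
  rewrite mul0e (_ : [set x | _] = set0) ?measure0//.
  by apply/seteqP; split => x //= -[h _]; apply: yB; exact/mem_set.
have e2 : ((lam \x lam) X2 = lam B * lam (phi @^-1` A))%E.
  rewrite product_measure_ysection//.
  rewrite muleC -int_indic//; last exact: mphiI.
  apply: eq_integral => y _; rewrite indicE.
  have [/set_mem yA|/negP yA] := boolP (y \in phi @^-1` A).
    rewrite mul1e -[in RHS](lebesgue_rV_shift (- phi y))//; congr (lam _).
    have BN z w : B (z - w) = B (w - z).
      by rewrite /B /eball /= !subr0 -enormN opprB.
    by apply/seteqP; split => [x /= [+ _]|x /=]; rewrite /= BN.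
  rewrite mul0e (_ : [set x | _] = set0) ?measure0//.
  by apply/seteqP; split => x //= -[_ h]; apply: yA; exact/mem_set.
have e12 : ((lam \x lam) X1 = (lam \x lam) X2)%E.
  rewrite !product_measure_xsection//; apply: eq_integral => x _.
  rewrite -[in RHS](lebesgue_rV_shift (x *m M^T)); last first.
    rewrite (_ : [set y | _] = xsection X2 x); first exact: measurable_xsection.
    by apply/seteqP; split => y /xsectionP.
  have phiD u v : phi (u + v) = phi u + phi v by rewrite /phi mulmxDl.
  by congr (lam _); apply/seteqP; split => y;
    rewrite /X1 /X2 /= phiD phiK addrK (addrC x).
have B0 : (0 < lam B)%E := lebesgue_rV_unit_eball_gt0.
have Boo : (lam B < +oo)%E := lebesgue_rV_eball_fin _ _.
have Bfin : lam B \is a fin_num by rewrite ge0_fin_numE.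
have e3 : (lam B * lam (phi @^-1` A) = lam B * lam A)%E by rewrite -e1 -e2 e12.
change (lam (phi @^-1` A) = lam A).
apply/eqP; rewrite eq_le.
rewrite -(lee_pmul2l Bfin B0 (lam (phi @^-1` A)) (lam A)).
rewrite -(lee_pmul2l Bfin B0 (lam A) (lam (phi @^-1` A))).
by rewrite e3 lexx.
Qed.

End rotation.

(** * Volumes, first moments and regions between graphs *)

Section moments.
Context {R : realType} {n : nat}.
Variables (i0 : 'I_n) (p : 'rV[R]_n) (r : R).
Local Notation lam := (lebesgue_rV n).
Implicit Types (A B K O : set 'rV[R]_n).

Definition vol A : R := fine (lam A).
(** The moment about the hyperplane through [p] normal to the coordinate [i0]:
    it vanishes when [p] is the barycenter of [A]. *)
Definition mom A : R := \int[lam]_(x in A) (x 0 i0 - p 0 i0).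

Lemma vol_fin A : measurable A -> A `<=` eball p r -> lam A \is a fin_num.
Proof.
move=> mA Ar; rewrite ge0_fin_numE//.
apply: le_lt_trans (lebesgue_rV_eball_fin p r).
by apply: le_measure; rewrite ?inE//; exact: measurable_eball.
Qed.

Lemma volE A : measurable A -> A `<=` eball p r -> lam A = (vol A)%:E.
Proof. by move=> mA Ar; rewrite fineK// vol_fin. Qed.

Lemma eball_coord x : eball p r x -> `|x 0 i0 - p 0 i0| < r.
Proof.
by move=> xr; have := le_lt_trans (entry_le_enorm (x - p) i0) xr; rewrite !mxE.
Qed.

Lemma integrable_coord A : measurable A -> A `<=` eball p r ->
  lam.-integrable A (fun x => (x 0 i0 - p 0 i0)%:E).
Proof.
move=> mA Ar; apply: measurable_bounded_integrable => //.
- by rewrite -ge0_fin_numE// vol_fin.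
- apply: measurable_funTS; apply: measurable_funB => //.
  exact: measurable_coord.
- exists r; split; first by rewrite num_real.
  move=> M rM x /= Ax; apply: ltW; apply: lt_trans rM.
  by apply: eball_coord; exact: Ar.
Qed.

Lemma integral_affine A a b : measurable A -> A `<=` eball p r ->
  (\int[lam]_(x in A) (a + b * (x 0 i0 - p 0 i0))%:E = (a * vol A + b * mom A)%:E)%E.
Proof.
move=> mA Ar; have ic := integrable_coord mA Ar.
have mfin : (lam A < +oo)%E by rewrite -ge0_fin_numE// vol_fin.
have icst : lam.-integrable A (fun=> a%:E).
  apply: (@measurable_bounded_integrable _ _ _ _ (cst a)) => //.
  exists `|a|; split; first by rewrite num_real.
  by move=> M aM x _ /=; exact: ltW.
under eq_integral do rewrite EFinD EFinM.
rewrite integralD//; last exact: integrableZl.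
rewrite EFinD !EFinM; congr (_ + _)%E.
  by rewrite integral_cst//; congr (_ * _)%E; exact: volE.
rewrite integralZl//; congr (_ * _)%E.
by rewrite fineK//; exact: integrable_fin_num.
Qed.

Lemma affine_ge0 A a b : measurable A -> A `<=` eball p r ->
  (forall x, A x -> 0 <= a + b * (x 0 i0 - p 0 i0)) ->
  0 <= a * vol A + b * mom A.
Proof.
move=> mA Ar H; rewrite -lee_fin -integral_affine//.
by apply: integral_ge0 => x Ax; rewrite lee_fin H.
Qed.

(** The affine functions [r + x_i0 - p_i0] and [r - (x_i0 - p_i0)] are
    nonnegative on the ball. *)
Lemma normr_mom_le A : measurable A -> A `<=` eball p r ->
  `|mom A| <= r * vol A.
Proof.
move=> mA Ar; rewrite ler_norml; apply/andP; split.
- rewrite lerNl -subr_ge0 opprK -[mom A]mul1r; apply: affine_ge0 => // x Ax.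
  have := eball_coord (Ar _ Ax); rewrite ltr_norml mul1r => /andP[h _].
  by rewrite addrC -[r]opprK subr_ge0 ltW.
- rewrite -subr_ge0 -mulN1r; apply: affine_ge0 => // x Ax.
  have := eball_coord (Ar _ Ax); rewrite ltr_norml mulN1r => /andP[_ h].
  by rewrite subr_ge0 ltW.
Qed.

Lemma volD A B : measurable A -> measurable B -> A `<=` B -> B `<=` eball p r ->
  vol B = vol A + vol (B `\` A).
Proof.
move=> mA mB AB Br; have Ar := subset_trans AB Br.
have mBA : measurable (B `\` A) by exact: measurableD.
rewrite /vol -[in LHS](setDUK AB) measureU ?setDIK// fineD// vol_fin//.
by move=> x [/Br].
Qed.

Lemma momD A B : measurable A -> measurable B -> A `<=` B -> B `<=` eball p r ->
  mom B = mom A + mom (B `\` A).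
Proof.
move=> mA mB AB Br; rewrite /mom -[in LHS](setDUK AB) Rintegral_setU//.
- exact: measurableD.
- by rewrite setDUK//; exact: integrable_coord.
- by rewrite disj_set2E setDIK eqxx.
Qed.

Lemma open_inner_regular O (e : R) : open O -> O `<=` eball p r -> 0 < e ->
  exists K, [/\ compact K, K `<=` O & vol O <= vol K + e].
Proof.
move=> oO Or e0; have [K [cK ndK OE]] := open_exhaustion oO.
have mO := measurable_open_rV oO.
have mK k := measurable_compact_rV (cK k).
have KO k : K k `<=` O by rewrite OE; exact: bigcup_sup.
have : lam \o K @ \oo --> lam O.
  by rewrite OE; apply: nondecreasing_cvg_mu => //; rewrite -OE.
rewrite volE// => cv.
have cvr : (vol \o K) @ \oo --> vol O by exact: fine_cvg cv.
have /cvgrPdist_le/(_ _ e0)[k _ H] := cvr.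
exists (K k); split => //.
by have := H k (leqnn k); rewrite /= ler_norml => /andP[_]; rewrite lerBlDr addrC.
Qed.

(** Complement inside [O] of a compact set that nearly exhausts [O \ K]. *)
Lemma compact_outer_regular K O (e : R) : compact K -> open O -> K `<=` O ->
  O `<=` eball p r -> 0 < e ->
  exists U, [/\ open U, K `<=` U, U `<=` O & vol U <= vol K + e].
Proof.
move=> cK oO KO Or e0.
have clK : closed K by apply: compact_closed => //; exact: norm_hausdorff.
have oOK : open (O `\` K) by apply: openI => //; rewrite openC.
have OKr : O `\` K `<=` eball p r by move=> x [/Or].
have [L [cL LO vL]] := open_inner_regular oOK OKr e0.
have clL : closed L by apply: compact_closed => //; exact: norm_hausdorff.
have mK := measurable_compact_rV cK; have mL := measurable_compact_rV cL.
have mO := measurable_open_rV oO; have mOK := measurable_open_rV oOK.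
have oU : open (O `\` L) by apply: openI => //; rewrite openC.
exists (O `\` L); split => //.
  by move=> x Kx; split; [exact: KO|move=> /LO[]].
have KOr := volD mK mO KO Or.
have LOK := volD mL mOK LO OKr.
have LO' : L `<=` O by move=> x /LO[].
by have := volD mL mO LO' Or; lra.
Qed.

End moments.

Section region.
Context {R : realType} {n : nat}.
Local Notation lam := (lebesgue_rV n).

Definition region (A : set 'rV[R]_n) (al be : 'rV[R]_n -> R) : set 'rV[R]_n.+1 :=
  [set y | A (rV_uncons y).2 /\
     al (rV_uncons y).2 <= (rV_uncons y).1 <= be (rV_uncons y).2].

Lemma measurable_region A al be : measurable A -> measurable_fun setT al ->
  measurable_fun setT be -> measurable (region A al be).
Proof.
move=> mA mal mbe.
have m1 : measurable_fun [set: 'rV[R]_n.+1] (fun y => (rV_uncons y).1 : R).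
  by apply: (measurableT_comp measurable_fst); exact: measurable_rV_uncons.
have m2 : measurable_fun [set: 'rV[R]_n.+1] (fun y => (rV_uncons y).2).
  by apply: (measurableT_comp measurable_snd); exact: measurable_rV_uncons.
apply: measurableI.
  by rewrite -[X in measurable X]setTI; exact: m2.
rewrite (_ : (fun _ => _) =
  [set y | ((al (rV_uncons y).2 <= (rV_uncons y).1) &&
            ((rV_uncons y).1 <= be (rV_uncons y).2)) = true]); last first.
  by apply/seteqP; split.
rewrite -[X in measurable X]setTI.
have mb : measurable_fun [set: 'rV[R]_n.+1] (fun y =>
  (al (rV_uncons y).2 <= (rV_uncons y).1) && ((rV_uncons y).1 <= be (rV_uncons y).2)).
  apply: measurable_and; apply: measurable_fun_ler => //.
  exact: (measurableT_comp mal).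
  exact: (measurableT_comp mbe).
exact: (mb measurableT [set true]).
Qed.

Lemma lebesgue_rV_region A al be : measurable A -> measurable_fun setT al ->
  measurable_fun setT be ->
  (lebesgue_rV n.+1 (region A al be) =
   \int[lam]_(x in A) (Num.max 0 (be x - al x))%:E)%E.
Proof.
move=> mA mal mbe; have mr := measurable_region mA mal mbe.
rewrite /= /lebesgue_step /pushforward product_measure_ysection; last first.
  by rewrite -[X in measurable X]setTI; exact: measurable_rV_cons.
rewrite [in RHS]integral_mkcond; apply: eq_integral => x _.
have E (y : R) : region A al be (rV_cons (y, x)) <-> A x /\ al x <= y <= be x.
  by rewrite /region /mkset rV_consK.
rewrite patchE; case: ifPn => [/set_mem Ax|/negP xA].
  rewrite (_ : [set _ | _] = `[al x, be x]%classic); last first.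
    apply/seteqP; split => y; first by move=> /E[_]; rewrite /= in_itv.
    by rewrite /= in_itv/= => h; apply/E.
  apply: etrans (lebesgue_measure_itv `[al x, be x]) _.
  rewrite /= lte_fin; case: ltP => h.
    by rewrite -EFinB (max_idPr _)// subr_ge0 ltW.
  by rewrite (max_idPl _)// subr_le0.
rewrite (_ : [set _ | _] = set0) ?measure0//.
by apply/seteqP; split => y // /E[Ax _]; apply: xA; exact/mem_set.
Qed.

End region.

(** * Interval functions and norm estimates *)

Section interval_functions.
Context {R : realType}.
Implicit Types (a b s t m : R).

(** Cousin's lemma, as an induction principle for properties of intervals: the
    supremum of the [x] such that [P a x] holds can neither fail to be attained
    nor be less than [b], since [P] holds on the short intervals around it. *)
Lemma itv_local_ind (P : R -> R -> Prop) a b : a <= b ->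
  (forall s m t, a <= s -> s <= m -> m <= t -> t <= b -> P s m -> P m t -> P s t) ->
  (forall t0, a <= t0 <= b -> exists2 d : R, 0 < d & forall s t,
     a <= s -> s <= t0 -> t0 <= t -> t <= b -> t - s < d -> P s t) ->
  P a b.
Proof.
move=> ab Padd Ploc.
pose E := [set x | a <= x <= b /\ P a x].
have Ea : E a.
  split; first by rewrite lexx.
  have [|d d0 H] := Ploc a; first by rewrite lexx.
  by apply: H => //; rewrite subrr.
have Eb : ubound E b by move=> x [/andP[]].
have hsE : has_sup E by split; [exists a|exists b].
pose c := sup E.
have ac : a <= c by apply: ub_le_sup => //; exists b.
have cb : c <= b by apply: ge_sup => //; exists a.
have [|d d0 H] := Ploc c; first by rewrite ac.
have d20 : 0 < d / 2 by rewrite divr_gt0.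
have [x [/andP[ax xb] Pax] cx] := sup_adherent d20 hsE.
have xc : x <= c by apply: ub_le_sup; [exists b|split; rewrite ?ax].
pose t := Num.min b (c + d / 4).
have tb : t <= b by rewrite ge_min lexx.
have ct : c <= t by rewrite le_min cb lerDl divr_ge0// ltW.
have tc : t <= c + d / 4 by rewrite ge_min lexx orbT.
have Pat : P a t.
  apply: (Padd a x t) => //; first exact: le_trans ct.
  by apply: H => //; move: cx tc; rewrite -/c; lra.
have [cltb|bc] := ltP c b; last first.
  suff -> : b = t by [].
  by apply/eqP; rewrite eq_le tb andbT (le_trans bc).
suff : t <= c.
  rewrite /t ge_min leNgt cltb /= => h; exfalso; move: h d0; lra.
apply: ub_le_sup; first by exists b.
by split => //; rewrite tb (le_trans ac).
Qed.

Variables (a b : R) (g : R -> R).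
Hypothesis cg : {within `[a, b], continuous g}.
Local Notation mu := (@lebesgue_measure R).
Local Notation N s t := (\int[mu]_(x in `[s, t]) g x).

Let integrable_sub s t : a <= s -> t <= b -> mu.-integrable `[s, t] (EFin \o g).
Proof.
move=> as_ tb; apply: continuous_compact_integrable; first exact: segment_compact.
apply: continuous_subspaceW cg; apply: subset_itv; by rewrite bnd_simp.
Qed.

Lemma Rintegral_itvD s m t : a <= s -> s <= m -> m <= t -> t <= b ->
  N s t = N s m + N m t.
Proof.
move=> as_ sm mt tb.
have iN := integrable_sub as_ tb.
rewrite -(@Rintegral_itv_obnd_cbnd _ m (BRight t)).
  rewrite -(@Rintegral_itvB _ _ (BLeft s) (BRight t) m)//.
  by rewrite addrC subrK.
apply: integrableS iN => //; apply: subset_itvr; by rewrite bnd_simp.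
Qed.

Lemma Rintegral_itv_local t0 (e : R) : a <= t0 <= b -> 0 < e ->
  exists2 d : R, 0 < d & forall s t,
    a <= s -> s <= t0 -> t0 <= t -> t <= b -> t - s < d ->
    `|N s t - g t0 * (t - s)| <= e * (t - s).
Proof.
move=> t0ab e0.
have /subspace_continuousP/(_ t0) := cg.
rewrite /= in_itv/= => /(_ t0ab) /cvgrPdist_le /(_ _ e0).
rewrite near_withinE => /nbhs_ballP[d /= d0 H].
exists d => // s t as_ st0 t0t tb ts.
have iN := integrable_sub as_ tb.
have st : s <= t by exact: le_trans t0t.
have icst c : mu.-integrable `[s, t] (EFin \o cst c).
  by apply: continuous_compact_integrable; [exact: segment_compact|
    apply: continuous_subspaceT => x; exact: cvg_cst].
have Nc c : c * (t - s) = \int[mu]_(x in `[s, t]) (cst c) x.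
  rewrite Rintegral_cst//; congr (_ * _).
  rewrite [X in fine X](lebesgue_measure_itv `[s, t])/= lte_fin; case: ltP => // h.
  by apply/eqP; rewrite subr_eq0 eq_le st h.
have gb x : `[s, t]%classic x -> `|g t0 - g x| <= e.
  rewrite /= in_itv/= => /andP[sx xt]; apply: H.
    rewrite -ball_normE /= (le_lt_trans _ ts)// ler_norml; apply/andP; split; lra.
  by rewrite in_itv/= (le_trans as_)// (le_trans xt).
rewrite ler_distl; apply/andP; split.
  rewrite -mulrBl Nc; apply: le_Rintegral => // x /gb.
  by rewrite ler_distl => /andP[h1 h2] /=; lra.
rewrite -mulrDl Nc; apply: le_Rintegral => // x /gb.
by rewrite ler_distl => /andP[h1 h2] /=; lra.
Qed.

End interval_functions.

Section norm_bounds.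
Context {R : realType}.

Lemma normr_sum_le m (F : 'I_m -> R) c : (forall i, `|F i| <= c) ->
  `|\sum_(i < m) F i| <= m%:R * c.
Proof.
move=> Fc; rewrite (le_trans (ler_norm_sum _ _ _))//.
rewrite (le_trans (ler_sum _ (fun i _ => Fc i)))//.
by rewrite sumr_const card_ord mulr_natl.
Qed.

Lemma entry_le_mx_norm m k (A : 'M[R]_(m, k)) i j : `|A i j| <= `|A|.
Proof.
rewrite [leRHS]/Num.Def.normr /= mx_normrE.
exact: (le_bigmax _ (fun ij : 'I_m * 'I_k => `|A ij.1 ij.2|) (i, j)).
Qed.

Lemma mx_norm_le m k (A : 'M[R]_(m, k)) (e : R) :
  0 <= e -> (forall i j, `|A i j| <= e) -> `|A| <= e.
Proof.
move=> e0 H; rewrite [leLHS]/Num.Def.normr /= mx_normrE.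
by apply: bigmax_le.
Qed.

Lemma norm_rV_le m (x : 'rV[R]_m) (e : R) :
  0 <= e -> (forall i, `|x 0 i| <= e) -> `|x| <= e.
Proof. by move=> e0 H; apply: mx_norm_le => // i j; rewrite [i]ord1. Qed.

Lemma normr_mulmx_le m k (v : 'rV[R]_m) (A : 'M[R]_(m, k)) :
  `|v *m A| <= m%:R * (`|v| * `|A|).
Proof.
apply: mx_norm_le => [|i j]; first by rewrite !mulr_ge0.
rewrite mxE; apply: normr_sum_le => l.
by rewrite normrM ler_pM ?entry_le_mx_norm.
Qed.

Lemma normr_dotv_le m (u v : 'rV[R]_m) : `|dotv u v| <= m%:R * (`|u| * `|v|).
Proof.
by apply: normr_sum_le => l; rewrite normrM ler_pM ?entry_le_mx_norm.
Qed.

Lemma dotv_row m (M : 'M[R]_m) i j : dotv (row i M) (row j M) = (M *m M^T) i j.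
Proof. by rewrite mxE; apply: eq_bigr => k _; rewrite !mxE. Qed.

Lemma orthogonal_norm_le m (M : 'M[R]_m) : M *m M^T = 1%:M -> `|M| <= 1.
Proof.
move=> MM; apply: mx_norm_le => // i j.
have -> : M i j = row i M 0 j by rewrite mxE.
rewrite (le_trans (entry_le_enorm _ _))// /enorm dotv_row MM mxE eqxx.
by rewrite sqrtr1.
Qed.

End norm_bounds.

(** * The tube around a framed curve *)

Lemma cvg_within_dnbhs {R : realType} {U : topologicalType} (J : set R) (t0 : R)
    (h : R -> U) (l : U) :
  h t @[t --> within J (nbhs t0)] --> l -> h t @[t --> within J t0^'] --> l.
Proof.
move=> H A /H; rewrite /nbhs /= /within /=; rewrite /dnbhs /within /=.
by apply: filterS => t h1 _; exact: h1.
Qed.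

Lemma near_within_dnbhsP {R : realType} (J : set R) (t0 : R) (P : R -> Prop) :
  (\forall t \near within J t0^', P t) ->
  exists2 d : R, 0 < d & forall t, J t -> t != t0 -> `|t - t0| < d -> P t.
Proof.
rewrite /nbhs /= /within /dnbhs /within /= => /nbhs_ballP[d /= d0 H].
exists d => // t Jt tt0 td; apply: H => //.
by rewrite -ball_normE /= distrC.
Qed.

Lemma near_within_nbhsP {R : realType} (J : set R) (t0 : R) (P : R -> Prop) :
  (\forall t \near within J (nbhs t0), P t) ->
  exists2 d : R, 0 < d & forall t, J t -> `|t - t0| < d -> P t.
Proof.
rewrite near_withinE => /nbhs_ballP[d /= d0 H]; exists d => // t Jt td.
by apply: H => //; rewrite -ball_normE /= distrC.
Qed.

Lemma subv_coord {R : zmodType} m (u v : 'rV[R]_m) i :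
  (u - v) 0 i = u 0 i - v 0 i.
Proof. by rewrite !mxE. Qed.

(** Derivatives are limits along [J], hence one-sided at its ends.  In the
    application [i0] is the first coordinate, [V i0.+2] is [V_2], [nu] is the
    speed and [th] is [kappa_1 nu]. *)
Section frame.
Context {R : realType} {n : nat}.
Variables (i0 : 'I_n) (J : set R) (f : R -> 'rV[R]_n.+1)
  (V : nat -> R -> 'rV[R]_n.+1) (nu th : R -> R) (p : 'rV[R]_n) (r : R).
Local Notation W t := (frame_mx V n.+1 t).

Hypothesis orthW : forall t, J t -> W t *m (W t)^T = 1%:M.
Hypothesis contf : forall t0, J t0 -> f t @[t --> within J (nbhs t0)] --> f t0.
Hypothesis contV : forall t0 j, J t0 -> (1 <= j <= n.+1)%N ->
  V j t @[t --> within J (nbhs t0)] --> V j t0.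
Hypothesis derf : forall t0, J t0 ->
  (t - t0)^-1 *: (f t - f t0) @[t --> within J t0^'] --> nu t0 *: V 1 t0.
Hypothesis derV : forall t0, J t0 ->
  (t - t0)^-1 *: (V 1 t - V 1 t0) @[t --> within J t0^'] -->
  th t0 *: V i0.+2 t0.

Definition emb (x : 'rV[R]_n) : 'rV[R]_n.+1 := rV_cons (0, x).

(** Orthonormal coordinates given by the frame at [t], normalised so that the
    tube map is [rig t] on the hyperplane [emb _] of points with zero first
    coordinate. *)
Definition rig t (y : 'rV[R]_n.+1) : 'rV[R]_n.+1 := f t + (y - emb p) *m W t.

(** Signed distance to the normal hyperplane of the curve at [t] of the point
    with coordinates [y] in the frame at [t0]. *)
Definition hgt t0 t (y : 'rV[R]_n.+1) : R := dotv (rig t0 y - f t) (V 1 t).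

(** The Jacobian of the tube map at [(x, t)]. *)
Definition jac t (x : 'rV[R]_n) : R := nu t - th t * (x 0 i0 - p 0 i0).

Let row_W t (i : 'I_n.+1) : row i (W t) = V i.+1 t.
Proof. by apply/rowP => j; rewrite !mxE. Qed.

Let WtW t : J t -> (W t)^T *m W t = 1%:M.
Proof. by move=> Jt; apply: mulmx1C; exact: orthW. Qed.

Let dotv_W t z (i : 'I_n.+1) : J t -> dotv (z *m W t) (V i.+1 t) = z 0 i.
Proof.
move=> Jt; rewrite -row_W.
transitivity ((z *m W t *m (W t)^T) 0 i).
  by rewrite [RHS]mxE; apply: eq_bigr => k _; congr (_ * _); rewrite !mxE.
by rewrite -mulmxA orthW// mulmx1.
Qed.

Lemma emb0 x : emb x 0 ord0 = 0. Proof. by rewrite /emb rV_cons0E. Qed.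

Lemma embS x j : emb x 0 (lift ord0 j) = x 0 j.
Proof. by rewrite /emb rV_consSE. Qed.

Lemma tube_mapE x t : tube_map f V p (x, t) = rig t (emb x).
Proof.
rewrite /tube_map /rig /=; congr (_ + _).
rewrite mulmx_sum_row big_ord_recl subv_coord !emb0 subrr scale0r add0r.
by apply: eq_bigr => j _; rewrite row_W subv_coord !embS.
Qed.

Lemma hgt_eq0 t0 t y x : J t -> rig t0 y = rig t (emb x) -> hgt t0 t y = 0.
Proof.
move=> Jt e; rewrite /hgt e /rig addrC addKr.
by rewrite (dotv_W _ ord0 Jt) subv_coord !emb0 subrr.
Qed.

Lemma hgt_eq0_ex t0 t y : J t -> hgt t0 t y = 0 ->
  exists x, rig t0 y = rig t (emb x).
Proof.
move=> Jt h0; pose z := (rig t0 y - f t) *m (W t)^T.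
have zE : z *m W t = rig t0 y - f t by rewrite /z -mulmxA WtW// mulmx1.
have z0 : z 0 ord0 = 0 by rewrite -(dotv_W _ ord0 Jt) zE.
exists (\row_j z 0 (lift ord0 j) + p); rewrite [in RHS]/rig.
rewrite (_ : _ - emb p = z) ?zE; first by rewrite addrC subrK.
apply/rowP => i; rewrite subv_coord.
by case: (unliftP ord0 i) => [j|] ->; rewrite ?emb0 ?embS ?subrr ?z0// !mxE addrK.
Qed.

(** First-order expansion in [t], uniform for bounded [y].  Writing
    [u = rig t0 y - f t0], the height is [<u, V_1 t> - <f t - f t0, V_1 t>], where
    [<u, V_1 t0>] is the first coordinate of [y], [V_1' = th V_2] contributes
    [th (y_1 - p_1) (t - t0)] and [f' = nu V_1] contributes [- nu (t - t0)]. *)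
Lemma hgt_estimate t0 (C e : R) : J t0 -> 0 < e ->
  exists2 d : R, 0 < d & forall t, J t -> `|t - t0| < d -> forall y, `|y| <= C ->
    `|hgt t0 t y - ((rV_uncons y).1 - jac t0 (rV_uncons y).2 * (t - t0))|
      <= e * `|t - t0|.
Proof.
move=> Jt0 e0.
pose N : R := n.+1%:R; have N0 : 0 < N by rewrite ltr0n.
pose C1 := N * (`|C| + `|emb p|).
have C10 : 0 <= C1 by rewrite mulr_ge0// ?addr_ge0// ltW.
pose e1 := e / (2 * (N * (C1 + 1))).
have D0 : 0 < N * (C1 + 1) by rewrite mulr_gt0//; lra.
have e10 : 0 < e1 by rewrite divr_gt0// mulr_gt0.
have e20 : 0 < e / 2 by rewrite divr_gt0.
have cV1 : V 1 t @[t --> within J t0^'] --> V 1 t0.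
  by apply: cvg_within_dnbhs; exact: contV.
have V11 : dotv (V 1 t0) (V 1 t0) = 1.
  by rewrite -(row_W t0 ord0) dotv_row orthW// mxE.
have n1 : \forall t \near within J t0^',
    `|nu t0 - dotv ((t - t0)^-1 *: (f t - f t0)) (V 1 t)| <= e / 2.
  have : dotv ((t - t0)^-1 *: (f t - f t0)) (V 1 t) @[t --> within J t0^'] --> nu t0.
    have -> : nu t0 = dotv (nu t0 *: V 1 t0) (V 1 t0) by rewrite dotvZl V11 mulr1.
    by apply: cvg_dotv => //; exact: derf.
  by move=> /cvgrPdist_le; apply.
have n2 : \forall t \near within J t0^',
    `|th t0 *: V i0.+2 t0 - (t - t0)^-1 *: (V 1 t - V 1 t0)| <= e1.
  by have /cvgrPdist_le := derV Jt0; apply.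
have [d d0 H] := near_within_dnbhsP (filterI n1 n2).
exists d => // t Jt td y yC.
have hE : hgt t0 t y = dotv (f t0 - f t) (V 1 t) + dotv ((y - emb p) *m W t0) (V 1 t).
  by rewrite /hgt /rig addrAC [LHS]dotvDl.
have y1 : (rV_uncons y).1 = y 0 ord0.
  by rewrite -{2}(rV_unconsK y) rV_cons0E.
have y2 j : (rV_uncons y).2 0 j = y 0 (lift ord0 j).
  by rewrite -{2}(rV_unconsK y) rV_consSE.
have h0 : dotv ((y - emb p) *m W t0) (V 1 t0) = y 0 ord0.
  by rewrite (dotv_W _ ord0 Jt0) subv_coord emb0 subr0.
have [tt0|tt0] := eqVneq t t0.
  rewrite hE tt0 h0 y1 !subrr mulr0 subr0 normr0 mulr0.
  by rewrite [dotv 0 _]big1 ?add0r ?subrr ?normr0// => i _; rewrite mxE mul0r.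
have [h1 h2] := H _ Jt tt0 td.
set tau := t - t0 in h1 h2 td *.
have tau0 : tau != 0 by rewrite subr_eq0.
pose A := dotv (tau^-1 *: (f t - f t0)) (V 1 t).
pose B := dotv ((y - emb p) *m W t0) (tau^-1 *: (V 1 t - V 1 t0) - th t0 *: V i0.+2 t0).
have e1E : dotv (f t0 - f t) (V 1 t) = - (tau * A).
  by rewrite /A dotvZl mulrA divff// mul1r !dotvBl opprB.
have e2E : dotv ((y - emb p) *m W t0) (V 1 t) =
    y 0 ord0 + tau * B + tau * (th t0 * ((rV_uncons y).2 0 i0 - p 0 i0)).
  rewrite /B dotvBr !dotvZr dotvBr h0 (dotv_W _ (lift ord0 i0) Jt0) y2 subv_coord embS.
  by field.
rewrite hE e1E e2E y1 /jac.
rewrite (_ : _ - _ = tau * ((nu t0 - A) + B)); last by ring.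
rewrite normrM mulrC ler_wpM2r//.
rewrite (le_trans (ler_normD _ _))// [leRHS](splitr e) lerD//.
rewrite (le_trans (normr_dotv_le _ _))// -/N.
have z1 : `|(y - emb p) *m W t0| <= C1.
  apply: le_trans (normr_mulmx_le _ _) _; rewrite /C1 ler_pM2l//.
  rewrite -[leRHS]mulr1 ler_pM ?orthogonal_norm_le ?orthW//.
  by rewrite (le_trans (ler_normB _ _))// lerD2r (le_trans yC)// ler_norm.
have z2 : `|tau^-1 *: (V 1 t - V 1 t0) - th t0 *: V i0.+2 t0| <= e1 by rewrite distrC.
apply: (@le_trans _ _ (N * (C1 * e1))).
  by rewrite ler_pM2l// ler_pM.
have -> : e / 2 = N * ((C1 + 1) * e1).
  by rewrite /e1; field; rewrite !gt_eqF//; lra.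
by rewrite ler_pM2l// ler_pM2r//; lra.
Qed.

Lemma rig_diff s t y z : J s -> rig s y = rig t z ->
  y - z = ((f t - f s) + (z - emb p) *m (W t - W s)) *m (W s)^T.
Proof.
move=> Js e.
have e' : (y - emb p) *m W s = (f t - f s) + (z - emb p) *m W t.
  by rewrite addrAC -[f t + _]/(rig t z) -e /rig addrC addKr.
have -> : y - z = (y - emb p) - (z - emb p) by rewrite opprB addrA subrK.
rewrite -[y - emb p in LHS]mulmx1 -[z - emb p in LHS]mulmx1 -(orthW Js) !mulmxA.
rewrite -mulmxBl e'; congr (_ *m _).
by rewrite mulmxBr addrA.
Qed.

(** The coordinates of a point in the frames at [t0] and at a nearby instant
    are close, uniformly as soon as one of the two is known to be bounded. *)
Lemma rig_close t0 (C e : R) : J t0 -> 0 < e ->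
  exists2 d : R, 0 < d & forall t, J t -> `|t - t0| < d -> forall y z,
    rig t0 y = rig t z -> `|y| <= C \/ `|z| <= C -> `|y - z| < e.
Proof.
move=> Jt0 e0.
pose N : R := n.+1%:R; have N0 : 0 < N by rewrite ltr0n.
pose C1 := `|C| + `|emb p|; have C10 : 0 <= C1 by rewrite addr_ge0.
pose e1 := e / (2 * (N * (1 + N * C1))).
have D1 : 0 < 1 + N * C1 by rewrite ltr_pwDl// mulr_ge0// ltW.
have e10 : 0 < e1 by rewrite divr_gt0// !mulr_gt0.
have n1 : \forall t \near within J (nbhs t0), `|f t0 - f t| <= e1.
  by have /cvgrPdist_le := contf Jt0; apply.
have n2 : \forall t \near within J (nbhs t0), forall i : 'I_n.+1,
    `|V i.+1 t0 - V i.+1 t| <= e1.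
  apply: filter_forall => i.
  have iN : (1 <= i.+1 <= n.+1)%N by exact: ltn_ord.
  by have /cvgrPdist_le := contV Jt0 iN; apply.
have [d d0 H] := near_within_nbhsP (filterI n1 n2).
exists d => // t Jt td y z e' yz.
have [h1 h2] := H t Jt td.
have hW : `|W t0 - W t| <= e1.
  apply: mx_norm_le => [|i j]; first exact: ltW.
  apply: le_trans (h2 i); rewrite -row_W -(row_W t).
  by rewrite (le_trans _ (entry_le_mx_norm _ 0 j))// !mxE.
(* [rig_diff] bounds the difference by means of the second point only, so it
   is used in both directions. *)
have key s s' (y' z' : 'rV[R]_n.+1) : J s -> J s' -> rig s y' = rig s' z' ->
    `|z'| <= C -> `|f s' - f s| <= e1 -> `|W s' - W s| <= e1 -> `|y' - z'| < e.
  move=> Js Js' ee zC hf hWs; rewrite (rig_diff Js ee).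
  rewrite (le_lt_trans (normr_mulmx_le _ _))// -/N.
  apply: (@le_lt_trans _ _ (N * (e1 * (1 + N * C1)))).
    rewrite ler_pM2l// -[leRHS]mulr1 ler_pM//; last first.
      apply: orthogonal_norm_le; rewrite trmxK; exact: WtW.
    rewrite (le_trans (ler_normD _ _))// mulrDr mulr1 lerD//.
    rewrite (le_trans (normr_mulmx_le _ _))// -/N [leRHS]mulrCA ler_pM2l// [leRHS]mulrC ler_pM//.
    by rewrite (le_trans (ler_normB _ _))// lerD2r (le_trans zC)// ler_norm.
  have -> : N * (e1 * (1 + N * C1)) = e / 2.
    have fE (x1 x2 : R) : 0 < x1 -> 0 < x2 -> x1 * (e / (2 * (x1 * x2)) * x2) = e / 2.
      by move=> x10 x20; field; rewrite !gt_eqF.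
    exact: fE.
  by rewrite ltr_pdivrMr// mulr_natr mulr2n ltrDl.
case: yz => [yC|zC].
  by rewrite distrC; apply: (key t t0).
by apply: (key t0 t) => //; rewrite distrC.
Qed.

Lemma measurable_rig t : measurable_fun setT (rig t).
Proof.
rewrite (_ : rig t = (fun y => y + f t) \o (fun y => y *m W t) \o (fun y => y + - emb p)).
  apply: measurableT_comp; last exact: measurable_shift.
  by apply: measurableT_comp; [exact: measurable_shift|exact: measurable_mulmx].
by apply/funext => y; rewrite /rig /= addrC.
Qed.

Lemma lebesgue_rV_rig t A : J t -> measurable A ->
  lebesgue_rV n.+1 (rig t @^-1` A) = lebesgue_rV n.+1 A.
Proof.
move=> Jt mA.
have mA1 : measurable ((fun y => y + f t) @^-1` A).
  by rewrite -[X in measurable X]setTI; exact: measurable_shift.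
have mA2 : measurable ((fun y => y *m W t) @^-1` ((fun y => y + f t) @^-1` A)).
  by rewrite -[X in measurable X]setTI; exact: measurable_mulmx.
rewrite -[RHS](lebesgue_rV_shift (f t))// -[RHS](lebesgue_rV_mulmx (orthW Jt))//.
rewrite -[RHS](lebesgue_rV_shift (- emb p))//.
by congr (lebesgue_rV n.+1 _); apply/seteqP; split => y; rewrite /= /rig addrC.
Qed.

Lemma compact_tube K I : compact K -> compact I -> I `<=` J ->
  compact (tube f V p K I).
Proof.
move=> cK cI IJ; apply: continuous_compact; last exact: compact_setX.
apply/subspace_continuousP => -[x t] [/= Kx It].
have Jt := IJ _ It.
have c2 : snd z @[z --> within (K `*` I) (nbhs (x, t))] --> within J (nbhs t).
  have cs : snd z @[z --> nbhs (x, t)] --> nbhs t by exact: cvg_snd.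
  move=> B nB; have nB' : nbhs t (fun t' => J t' -> B t') by exact: nB.
  suff : nbhs (x, t) (fun z => (K `*` I) z -> B z.2) by [].
  have F : nbhs (x, t) (fun z => J z.2 -> B z.2) by exact: (cs _ nB').
  apply: filterS F => -[x' t'] /= H [_ It'].
  by apply: H; exact: IJ.
have c1 : fst z @[z --> within (K `*` I) (nbhs (x, t))] --> x.
  have cf : fst z @[z --> nbhs (x, t)] --> nbhs x by exact: cvg_fst.
  by apply: cvg_trans cf; apply: cvg_app; exact: cvg_within.
rewrite /tube_map /=; apply: cvgD.
  exact: (cvg_comp _ _ c2 (contf Jt)).
apply: cvg_big => [|j _]; first exact: add_continuous.
apply: cvgZ.
  apply: cvgB; last exact: cvg_cst.
  by apply: (cvg_comp _ (fun u : 'rV[R]_n => u 0 j) c1); exact: coord_continuous.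
apply: (cvg_comp _ _ c2); apply: contV => //.
exact: (ltn_ord (lift ord0 j)).
Qed.

Hypothesis nu_gt0 : forall t, J t -> 0 < nu t.
Hypothesis accJ : forall t (d : R), J t -> 0 < d ->
  exists t', [/\ J t', t' != t & `|t' - t| < d].
Hypothesis injG : set_inj (eball p r `*` J) (tube_map f V p).

Let open_O : open (eball p r). Proof. exact: open_eball. Qed.

Let norm_emb_le x : `|emb x| <= `|x|.
Proof.
apply: norm_rV_le => // i.
by case: (unliftP ord0 i) => [j|] ->; rewrite ?emb0 ?embS ?normr0// entry_le_mx_norm.
Qed.

Let norm_emb_sub_lt x z e : `|emb x - emb z| < e -> `|x - z| < e.
Proof.
move=> h; apply: le_lt_trans h; apply: norm_rV_le => // j.
by rewrite subv_coord -2!embS -subv_coord entry_le_mx_norm.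
Qed.

Let embD c x : emb (p + c *: (x - p)) - emb p = c *: (emb x - emb p).
Proof.
apply/rowP => i; rewrite subv_coord [RHS]mxE subv_coord.
case: (unliftP ord0 i) => [j|] ->; rewrite ?emb0 ?embS.
  by rewrite !mxE addrAC subrr add0r.
by rewrite subrr mulr0.
Qed.

Let jac_p t : jac t p = nu t.
Proof. by rewrite /jac subrr mulr0 subr0. Qed.

Let uncons_emb x : rV_uncons (emb x) = (0, x).
Proof. by rewrite /emb rV_consK. Qed.

(** If [jac t0 x] were negative, then for [t] close to [t0] the points of the
    normal hyperplane at [t0] over [p] and over [x] would have, by
    [hgt_estimate], heights of opposite signs with respect to the normal
    hyperplane at [t].  The height being affine along the segment from [p] to
    [x], some point of that segment would lie on both hyperplanes and would be
    attained twice by the tube map. *)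
Lemma jac_ge0 t0 x : J t0 -> eball p r x -> 0 <= jac t0 x.
Proof.
move=> Jt0 xr; rewrite leNgt; apply/negP => jx0.
have nu0 := nu_gt0 Jt0.
pose pt (c : R) := p + c *: (x - p).
pose K := pt @` `[0, 1]%classic.
have cK : compact K.
  apply: continuous_compact; last exact: segment_compact.
  apply: continuous_subspaceT => c; apply: cvgD; first exact: cvg_cst.
  by apply: cvgZl; exact: cvg_id.
have KO : K `<=` eball p r.
  move=> _ [c /= + <-]; rewrite in_itv/= => /andP[c0 c1].
  rewrite /eball /= /pt addrAC subrr add0r enormZ ger0_norm//.
  by rewrite (le_lt_trans _ xr)// ler_piMl// sqrtr_ge0.
have [eta eta0 thick] := compact_thickening cK open_O KO.
pose C := `|p| + `|x - p|.
have ptC c : 0 <= c <= 1 -> `|emb (pt c)| <= C.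
  move=> /andP[c0 c1]; rewrite (le_trans (norm_emb_le _))//.
  rewrite (le_trans (ler_normD _ _))// lerD2l normrZ ger0_norm//.
  by rewrite ler_piMl.
pose e := Num.min (nu t0) (- jac t0 x) / 2.
have m0 : 0 < Num.min (nu t0) (- jac t0 x) by rewrite lt_min nu0 oppr_gt0.
have e0 : 0 < e by rewrite divr_gt0.
have e1 : e < nu t0.
  by rewrite (@lt_le_trans _ _ (Num.min (nu t0) (- jac t0 x)))// ?ge_min ?lexx// /e; lra.
have e2 : e < - jac t0 x.
  by rewrite (@lt_le_trans _ _ (Num.min (nu t0) (- jac t0 x)))// ?ge_min ?lexx ?orbT// /e; lra.
have [d1 d10 est] := hgt_estimate C Jt0 e0.
have [d2 d20 close] := rig_close C Jt0 eta0.
have d0 : 0 < Num.min d1 d2 by rewrite lt_min d10.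
have [t [Jt tt0]] := accJ Jt0 d0; rewrite lt_min => /andP[td1 td2].
pose h c := hgt t0 t (emb (pt c)).
have hE c : h c = h 0 + c * (h 1 - h 0).
  have hc b : h b = dotv (f t0 - f t) (V 1 t) +
      b * dotv ((emb x - emb p) *m W t0) (V 1 t).
    by rewrite /h /hgt /rig embD addrAC [LHS]dotvDl -scalemxAl dotvZl.
  by rewrite !hc; ring.
have est_h c : 0 <= c <= 1 -> `|h c + jac t0 (pt c) * (t - t0)| <= e * `|t - t0|.
  move=> c01; have := est t Jt td1 _ (ptC _ c01).
  by rewrite uncons_emb /= sub0r opprK.
have := est_h 0; rewrite /pt scale0r addr0 jac_p lexx ler01 => /(_ isT) E0.
have := est_h 1; rewrite /pt scale1r [p + _]addrC subrK lexx ler01 => /(_ isT) E1.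
have [c c01 hc0] : exists2 c, 0 <= c <= 1 & h c = 0.
  have h01 : h 0 != h 1 /\ 0 <= h 0 / (h 0 - h 1) <= 1.
    have tau0 : t - t0 != 0 by rewrite subr_eq0.
    have [tau_gt0|tau_lt0] : 0 < t - t0 \/ t - t0 < 0.
    + by case: (ltgtP (t - t0) 0) tau0 => // hlt _; [right|left].
    + have a0 : h 0 < 0 by move: E0; rewrite (gtr0_norm tau_gt0) ler_norml => /andP[_]; nra.
      have a1 : 0 < h 1 by move: E1; rewrite (gtr0_norm tau_gt0) ler_norml => /andP[]; nra.
      rewrite lt_eqF ?(lt_trans a0)//; split => //.
      have h10 : 0 < h 1 - h 0 by lra.
      rewrite -[h 0 - _]opprB invrN mulrN -mulNr divr_ge0 ?ler_pdivrMr//; lra.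
    + have a0 : 0 < h 0 by move: E0; rewrite (ltr0_norm tau_lt0) ler_norml => /andP[]; nra.
      have a1 : h 1 < 0 by move: E1; rewrite (ltr0_norm tau_lt0) ler_norml => /andP[_]; nra.
      rewrite gt_eqF ?(lt_trans a1)//; split => //.
      have h10 : 0 < h 0 - h 1 by lra.
      rewrite divr_ge0 ?ler_pdivrMr//; lra.
  exists (h 0 / (h 0 - h 1)); first exact: h01.2.
  by rewrite hE; field; rewrite subr_eq0 h01.1.
have [z ez] := hgt_eq0_ex Jt hc0.
have zO : eball p r z.
  apply: (thick (pt c)); first by exists c => //; rewrite /= in_itv.
  apply: norm_emb_sub_lt; apply: (close t) => //; left; exact: ptC.
have Kc : K (pt c) by exists c => //; rewrite /= in_itv.
have : (pt c, t0) = (z, t).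
  apply: injG; rewrite ?inE; [by split => //; exact: KO|by split|].
  by rewrite !tube_mapE.
by move=> [_ /esym/eqP]; rewrite (negbTE tt0).
Qed.

Hypothesis r_gt0 : 0 < r.
Local Notation vol := (@vol R n).
Local Notation mom := (@mom R n i0 p).

Let norm_uncons_lt x y e : `|emb x - y| < e -> `|x - (rV_uncons y).2| < e.
Proof.
move=> h; apply: le_lt_trans h; apply: norm_rV_le => // j.
rewrite subv_coord -{1}embS -{1}(rV_consSE (rV_uncons y)) rV_unconsK -subv_coord.
exact: entry_le_mx_norm.
Qed.

Let measurable_jac t : measurable_fun setT (jac t).
Proof.
apply: measurable_funB => //; apply: measurable_funM => //.
by apply: measurable_funB => //; exact: measurable_coord.
Qed.

Let compact_norm_le (K : set 'rV[R]_n) : compact K ->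
  exists2 C : R, 0 <= C & forall x, K x -> `|x| <= C.
Proof.
move=> /compact_bounded[M [_ H]]; exists (`|M| + 1); first by rewrite addr_ge0.
by move=> x Kx; apply: H => //; rewrite (le_lt_trans (ler_norm M))// ltrDl.
Qed.

Let vol_ge0 A : 0 <= vol A.
Proof. by rewrite fine_ge0. Qed.

(** The integral of [jac t] over [B] exceeds that over [A] by little when
    [B \ A] is small, as [jac t] is bounded on the ball. *)
Let jac_defect t A B (d : R) : measurable A -> measurable B -> A `<=` B ->
  B `<=` eball p r -> vol B <= vol A + d ->
  `|(nu t * vol B - th t * mom B) - (nu t * vol A - th t * mom A)| <=
    (`|nu t| + `|th t| * r) * d.
Proof.
move=> mA mB AB Br vd.
have mBA : measurable (B `\` A) by exact: measurableD.
have BAr : B `\` A `<=` eball p r by move=> x [/Br].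
move: vd; rewrite (volD mA mB AB Br) (momD i0 mA mB AB Br) lerD2l => vd.
rewrite (_ : _ - _ = nu t * vol (B `\` A) - th t * mom (B `\` A)); last by ring.
rewrite (le_trans (ler_normB _ _))// !normrM mulrDl lerD//.
  by rewrite ler_wpM2l// ger0_norm.
rewrite -mulrA ler_wpM2l// (le_trans (normr_mom_le i0 mBA BAr))//.
by rewrite ler_pM2l.
Qed.

Let jac_bound t x : eball p r x -> `|jac t x| <= `|nu t| + `|th t| * r.
Proof.
move=> xr; rewrite (le_trans (ler_normB _ _))// lerD2l normrM ler_wpM2l//.
by rewrite ltW// (eball_coord i0 xr).
Qed.

(** In the coordinates of the frame at [t0], and for [s] and [t] close to [t0],
    the piece of the tube between [s] and [t] lies over a given open [U]
    containing [K], between the graphs of [jac t0 * (s - t0)] and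
    [jac t0 * (t - t0)] up to an arbitrarily small multiple of [t - s]. *)
Lemma tube_upper_local K t0 (e : R) : J t0 -> compact K -> K `<=` eball p r ->
  0 < e -> exists2 d : R, 0 < d & forall s t, s <= t0 -> t0 <= t ->
    `[s, t] `<=` J -> t - s < d ->
    (lebesgue_rV n.+1 (tube f V p K `[s, t]) <=
      ((nu t0 * vol K - th t0 * mom K + e) * (t - s))%:E)%E.
Proof.
move=> Jt0 cK Kr e0.
pose M := `|nu t0| + `|th t0| * r.
have M0 : 0 <= M by rewrite addr_ge0// mulr_ge0// ltW.
pose e1 := e / (2 * (M + 1)).
pose e2 := e / (4 * (vol (eball p r) + 1)).
have vO := vol_ge0 (eball p r).
have e10 : 0 < e1 by rewrite divr_gt0//; lra.
have e20 : 0 < e2 by rewrite divr_gt0//; lra.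
have [U [oU KU Ur vU]] := compact_outer_regular cK open_O Kr (fun _ x => x) e10.
have [eta eta0 thick] := compact_thickening cK oU KU.
have [C C0 HC] := compact_norm_le cK.
have [d1 d10 est] := hgt_estimate (C + eta) Jt0 e20.
have [d2 d20 close] := rig_close C Jt0 eta0.
exists (Num.min d1 d2) => [|s t st0 t0t stJ]; first by rewrite lt_min d10.
rewrite lt_min => /andP[ts1 ts2].
have mU := measurable_open_rV oU; have mK := measurable_compact_rV cK.
pose al x := jac t0 x * (s - t0) - e2 * (t - s).
pose be x := jac t0 x * (t - t0) + e2 * (t - s).
have mal : measurable_fun setT al.
  by apply: measurable_funB => //; apply: measurable_funM.
have mbe : measurable_fun setT be.
  by apply: measurable_funD => //; apply: measurable_funM.
have mtube : measurable (tube f V p K `[s, t]).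
  by apply: measurable_compact_rV; apply: compact_tube => //; exact: segment_compact.
rewrite -(lebesgue_rV_rig Jt0 mtube).
apply: (@le_trans _ _ (lebesgue_rV n.+1 (region U al be))).
  apply: le_measure; rewrite ?inE.
  - by rewrite -[X in measurable X]setTI; exact: measurable_rig.
  - exact: measurable_region.
  move=> y [[x t'] [/= Kx]]; rewrite in_itv/= => /andP[st' t't] E.
  have {}E : rig t0 y = rig t' (emb x) by rewrite -E tube_mapE.
  have Jt' : J t' by apply: stJ; rewrite /= in_itv/= st'.
  have tt : `|t' - t0| <= t - s by rewrite ler_norml; apply/andP; split; lra.
  have exC : `|emb x| <= C by rewrite (le_trans (norm_emb_le _))// HC.
  have yx : `|y - emb x| < eta.
    by apply: (close t') => //; [exact: le_lt_trans ts2|right].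
  have Uy : U (rV_uncons y).2.
    by apply: (thick x) => //; apply: norm_uncons_lt; rewrite distrC.
  have yC : `|y| <= C + eta.
    rewrite -[y](subrK (emb x)) addrC (le_trans (ler_normD _ _))// addrC.
    by rewrite addrC lerD// ltW.
  have := est t' Jt' (le_lt_trans tt ts1) y yC.
  rewrite (hgt_eq0 Jt' E) sub0r normrN => h.
  have {h} : `|(rV_uncons y).1 - jac t0 (rV_uncons y).2 * (t' - t0)| <= e2 * (t - s).
    by rewrite (le_trans h)// ler_pM2l.
  have j0 := jac_ge0 Jt0 (Ur _ Uy).
  rewrite ler_distl => /andP[h1 h2].
  split => //; apply/andP; rewrite /al /be; split.
    by apply: le_trans h1; rewrite lerD2r ler_wpM2l// lerD2r.
  by apply: (le_trans h2); rewrite lerD2r ler_wpM2l// lerD2r.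
rewrite lebesgue_rV_region//.
have ts0 : 0 <= t - s by lra.
rewrite (eq_integral (fun x : 'rV[R]_n => ((nu t0 + 2 * e2) * (t - s) +
    (- th t0 * (t - s)) * (x 0 i0 - p 0 i0))%:E)); last first.
  move=> x /set_mem Ux; congr EFin; rewrite (max_idPr _).
    by rewrite /al /be /jac; ring.
  rewrite (_ : _ - _ = (jac t0 x + 2 * e2) * (t - s)); last by rewrite /al /be; ring.
  have jx := jac_ge0 Jt0 (Ur _ Ux).
  by rewrite mulr_ge0// addr_ge0// mulr_ge0// ltW.
rewrite (integral_affine _ _ _ mU Ur) lee_fin.
rewrite (_ : _ + _ = (nu t0 * vol U - th t0 * mom U + 2 * e2 * vol U) * (t - s));
  last by ring.
rewrite ler_wpM2r//.
have vUO : vol U <= vol (eball p r).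
  by rewrite (volD mU (measurable_eball _ _) Ur (fun _ x => x)) lerDl.
have D1 : M * e1 <= e / 2.
  by rewrite /e1 mulrA ler_pdivrMr//; nra.
have D2 : 2 * e2 * vol U <= e / 2.
  apply: (@le_trans _ _ (2 * e2 * vol (eball p r))); first by rewrite ler_wpM2l// mulr_ge0// ltW.
  by rewrite /e2 !mulrA mulrAC ler_pdivrMr//; nra.
have := jac_defect t0 mK mU KU Ur vU; rewrite -/M ler_norml => /andP[_]; lra.
Qed.

(** Such a tube is a countable union of compact ones. *)
Lemma measurable_tube_open A s t : open A -> `[s, t[ `<=` J ->
  measurable (tube f V p A `[s, t[).
Proof.
move=> oA stJ; have [K [cK _ AE]] := open_exhaustion oA.
have -> : tube f V p A `[s, t[ =
    \bigcup_k \bigcup_l tube f V p (K k) `[s, t - l.+1%:R^-1].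
  apply/seteqP; split => [_ [[x u] [/= Ax]] + <-|_ [k _ [l _ [[x u] [/= Kx]]]] + <-].
    rewrite in_itv/= => /andP[su ut].
    move: Ax; rewrite AE => -[k _ Kx]; exists k => //.
    have [l] := @ltr_add_invr R u t ut; rewrite -ltrBrDr => ul.
    by exists l => //; exists (x, u) => //; split => //=; rewrite in_itv/= su ltW.
  rewrite in_itv/= => /andP[su ut]; exists (x, u) => //; split => /=.
    by rewrite AE; exists k.
  by rewrite in_itv/= su (le_lt_trans ut)// ltrBlDr ltrDl invr_gt0.
apply: bigcupT_measurable => k; apply: bigcupT_measurable => l.
apply: measurable_compact_rV; apply: compact_tube => //; first exact: segment_compact.
apply: subset_trans stJ => u; rewrite /= !in_itv/= => /andP[-> ut].
by rewrite (le_lt_trans ut)// ltrBlDr ltrDl invr_gt0.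
Qed.

(** Dually, over a compact [K] contained in [A], any point between the two
    graphs, moved inwards by a small multiple of [t - s], has a positive
    height with respect to the hyperplane at [s] and a negative one at [t]; by
    the intermediate value theorem it lies on that of some instant in
    between, and it belongs to the section [A] there by [rig_close]. *)
Lemma tube_lower_local A t0 (e : R) : J t0 -> open A -> A `<=` eball p r ->
  0 < e -> exists2 d : R, 0 < d & forall s t, s <= t0 -> t0 <= t ->
    `[s, t] `<=` J -> t - s < d ->
    (((nu t0 * vol A - th t0 * mom A - e) * (t - s))%:E <=
      lebesgue_rV n.+1 (tube f V p A `[s, t[))%E.
Proof.
move=> Jt0 oA Ar e0.
pose M := `|nu t0| + `|th t0| * r.
have M0 : 0 <= M by rewrite addr_ge0// mulr_ge0// ltW.
pose e1 := e / (2 * (M + 1)).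
pose e2 := e / (8 * (vol (eball p r) + 1)).
have vO := vol_ge0 (eball p r).
have e10 : 0 < e1 by rewrite divr_gt0//; lra.
have e20 : 0 < e2 by rewrite divr_gt0//; lra.
have [K [cK KA vA]] := open_inner_regular oA Ar e10.
have [eta eta0 thick] := compact_thickening cK oA KA.
have [C C0 HC] := compact_norm_le cK.
have [d1 d10 est] := hgt_estimate (C + 1) Jt0 e20.
have [d2 d20 close] := rig_close (C + 1) Jt0 eta0.
pose d3 := (M + 1)^-1; have d30 : 0 < d3 by rewrite invr_gt0; lra.
have Kr : K `<=` eball p r by exact: subset_trans Ar.
exists (Num.min d1 (Num.min d2 d3)) => [|s t st0 t0t stJ].
  by rewrite !lt_min d10 d20.
rewrite !lt_min => /andP[ts1 /andP[ts2 ts3]].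
have [->|st] := eqVneq s t; first by rewrite subrr mulr0.
have {}st : s < t by rewrite lt_neqAle st (le_trans st0).
have stJ' : `[s, t[ `<=` J by apply: subset_trans stJ; exact: subset_itv_co_cc.
have mA := measurable_open_rV oA; have mK := measurable_compact_rV cK.
pose al x := jac t0 x * (s - t0) + 2 * e2 * (t - s).
pose be x := jac t0 x * (t - t0) - 2 * e2 * (t - s).
have mal : measurable_fun setT al.
  by apply: measurable_funD => //; apply: measurable_funM.
have mbe : measurable_fun setT be.
  by apply: measurable_funB => //; apply: measurable_funM.
have mtube := measurable_tube_open oA stJ'.
rewrite -(lebesgue_rV_rig Jt0 mtube).
apply: (@le_trans _ _ (lebesgue_rV n.+1 (region K al be))); last first.
  apply: le_measure; rewrite ?inE.
  - exact: measurable_region.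
  - by rewrite -[X in measurable X]setTI; exact: measurable_rig.
  move=> y [Ky /andP[h1 h2]].
  have j0 := jac_ge0 Jt0 (Kr _ Ky).
  have jM := jac_bound t0 (Kr _ Ky); rewrite ger0_norm// -/M in jM.
  set y' := (rV_uncons y).2 in Ky h1 h2 j0 jM.
  set y0 := (rV_uncons y).1 in h1 h2.
  have e2ts : 0 < e2 * (t - s) by rewrite mulr_gt0// subr_gt0.
  have Mts : M * (t - s) <= 1.
    have : (M + 1) * (t - s) < 1 by rewrite -ltr_pdivlMl ?mulr1//; lra.
    by nra.
  have y01 : `|y0| <= 1.
    rewrite ler_norml; apply/andP; split.
      apply: le_trans h1; rewrite /al; nra.
    apply: (le_trans h2); rewrite /be; nra.
  have yC : `|y| <= C + 1.
    apply: norm_rV_le => [|i]; first lra.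
    rewrite -(rV_unconsK y); case: (unliftP ord0 i) => [j|] ->.
      rewrite rV_consSE (le_trans (entry_le_mx_norm _ 0 _))// (le_trans (HC _ Ky))//.
      by rewrite lerDl.
    by rewrite rV_cons0E (le_trans y01)// lerDr.
  have est' u : s <= u <= t ->
      `|hgt t0 u y - (y0 - jac t0 y' * (u - t0))| <= e2 * (t - s).
    move=> /andP[su ut].
    have Ju : J u by apply: stJ; rewrite /= in_itv/= su.
    have tt : `|u - t0| <= t - s by rewrite ler_norml; apply/andP; split; lra.
    by rewrite (le_trans (est u Ju (le_lt_trans tt ts1) y yC))// ler_pM2l.
  have hs : 0 < hgt t0 s y.
    have := est' s; rewrite lexx ltW// ler_distl => /(_ isT)/andP[+ _].
    by apply: lt_le_trans; move: h1; rewrite /al; lra.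
  have ht : hgt t0 t y < 0.
    have := est' t; rewrite lexx ltW// ler_distl => /(_ isT)/andP[_].
    by move/le_lt_trans; apply; move: h2; rewrite /be; lra.
  (* [hgt t0 t y < 0] is strict, which keeps [u] away from the excluded end [t]. *)
  have [||u] := @IVT R (fun u => hgt t0 u y) s t 0 (ltW st).
  - apply/subspace_continuousP => u ust; have Ju := stJ _ ust.
    have sub : within `[s, t]%classic (nbhs u) `=>` within J (nbhs u).
      move=> B nB; suff : nbhs u (fun v => `[s, t]%classic v -> B v) by [].
      have F : nbhs u (fun v => J v -> B v) by exact: nB.
      by apply: filterS F => v H vst; apply: H; exact: stJ.
    have cf : f v @[v --> within `[s, t]%classic (nbhs u)] --> f u.
      by apply: cvg_trans (contf Ju); exact: cvg_app.
    have cV : V 1 v @[v --> within `[s, t]%classic (nbhs u)] --> V 1 u.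
      by apply: cvg_trans (@contV u 1 Ju isT); exact: cvg_app.
    apply: cvg_dotv cV; apply: cvgB cf; exact: cvg_cst.
  - by rewrite ge_min le_max (ltW ht) (ltW hs) orbT.
  rewrite in_itv/= => /andP[su ut] hu.
  have Ju : J u by apply: stJ; rewrite /= in_itv/= su.
  have [x xE] := hgt_eq0_ex Ju hu.
  have ut' : u < t by rewrite lt_neqAle ut andbT; apply/eqP => utE; move: ht; rewrite -utE hu ltxx.
  have tt : `|u - t0| <= t - s by rewrite ler_norml; apply/andP; split; lra.
  have yx : `|y - emb x| < eta.
    by apply: (close u) => //; [exact: le_lt_trans ts2|left].
  exists (x, u); last by rewrite tube_mapE.
  split => /=; last by rewrite in_itv/= su.
  apply: (thick y') => //; rewrite distrC; apply: norm_uncons_lt.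
  by rewrite distrC.
rewrite lebesgue_rV_region//.
have ts0 : 0 <= t - s by rewrite subr_ge0 ltW.
pose g (x : 'rV[R]_n) := (nu t0 - 4 * e2) * (t - s) + (- th t0 * (t - s)) * (x 0 i0 - p 0 i0).
apply: (@le_trans _ _ (\int[lebesgue_rV n]_(x in K) (g x)%:E)%E).
  rewrite (integral_affine _ _ _ mK Kr) lee_fin.
  rewrite [leRHS](_ : _ = (nu t0 * vol K - th t0 * mom K - 4 * e2 * vol K) * (t - s));
    last by ring.
  rewrite ler_wpM2r//.
  have vKO : vol K <= vol (eball p r).
    by rewrite (volD mK (measurable_eball _ _) Kr (fun _ x => x)) lerDl.
  have D1 : M * e1 <= e / 2.
    by rewrite /e1 mulrA ler_pdivrMr//; nra.
  have D2 : 4 * e2 * vol K <= e / 2.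
    apply: (@le_trans _ _ (4 * e2 * vol (eball p r))); first by rewrite ler_wpM2l// mulr_ge0// ltW.
    by rewrite /e2 !mulrA mulrAC ler_pdivrMr//; nra.
  have := jac_defect t0 mK mA KA Ar vA; rewrite -/M ler_norml => /andP[_]; lra.
have -> : (\int[lebesgue_rV n]_(x in K) (Num.max 0 (be x - al x))%:E =
           \int[lebesgue_rV n]_(x in K) ((EFin \o g)^\+ x))%E.
  apply: eq_integral => x _; rewrite funeposE /= maxC -EFin_max; congr (Num.max _ _)%:E.
  by rewrite /be /al /g /jac; ring.
rewrite integralE geeDl// oppe_le0; exact: integral_ge0.
Qed.

Variables (a b : R).
Hypothesis ab : a <= b.
Hypothesis abJ : `[a, b] `<=` J.
Hypothesis contnu : {within `[a, b], continuous nu}.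
Hypothesis contth : {within `[a, b], continuous th}.
Local Notation mu := (@lebesgue_measure R).
Let N s t := \int[mu]_(u in `[s, t]) nu u.
Let H s t := \int[mu]_(u in `[s, t]) th u.

Let sub_abJ s t : a <= s -> t <= b -> `[s, t] `<=` J.
Proof.
by move=> as_ tb; apply: subset_trans abJ; apply: subset_itv; rewrite bnd_simp.
Qed.

Let integral_local A t0 (e : R) : a <= t0 <= b -> 0 < e ->
  exists2 d : R, 0 < d & forall s t,
    a <= s -> s <= t0 -> t0 <= t -> t <= b -> t - s < d ->
    `|(N s t * vol A - H s t * mom A) -
      (nu t0 * vol A - th t0 * mom A) * (t - s)| <= e * (t - s).
Proof.
move=> t0ab e0.
pose e1 := e / (`|vol A| + `|mom A| + 1).
have D0 : 0 < `|vol A| + `|mom A| + 1 by rewrite ltr_pwDr ?addr_ge0.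
have e10 : 0 < e1 by rewrite divr_gt0.
have [d1 d10 h1] := Rintegral_itv_local contnu t0ab e10.
have [d2 d20 h2] := Rintegral_itv_local contth t0ab e10.
exists (Num.min d1 d2) => [|s t as_ st0 t0t tb]; first by rewrite lt_min d10.
rewrite lt_min => /andP[ts1 ts2].
have {}h1 := h1 s t as_ st0 t0t tb ts1.
have {}h2 := h2 s t as_ st0 t0t tb ts2.
have ts0 : 0 <= t - s by lra.
rewrite (_ : _ - _ = (N s t - nu t0 * (t - s)) * vol A -
                     (H s t - th t0 * (t - s)) * mom A); last by ring.
rewrite (le_trans (ler_normB _ _))// !normrM.
apply: (@le_trans _ _ (e1 * (t - s) * `|vol A| + e1 * (t - s) * `|mom A|)).
  by rewrite lerD// ler_wpM2r.
rewrite (_ : _ + _ = e1 * (`|vol A| + `|mom A|) * (t - s)); last by ring.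
rewrite ler_wpM2r// /e1 mulrAC ler_pdivrMr// ler_pM2l// lerDl//.
Qed.

Let N_add s m t : a <= s -> s <= m -> m <= t -> t <= b -> N s t = N s m + N m t.
Proof. exact: Rintegral_itvD contnu _ _ _. Qed.

Let H_add s m t : a <= s -> s <= m -> m <= t -> t <= b -> H s t = H s m + H m t.
Proof. exact: Rintegral_itvD contth _ _ _. Qed.

Let vanishing_slope (x y : \bar R) (c : R) : 0 <= c ->
  (forall e : R, 0 < e -> (x <= y + (e * c)%:E)%E) -> (x <= y)%E.
Proof.
move=> c0 Hxy; apply/lee_addgt0Pr => e e0.
have e10 : 0 < e / (c + 1) by rewrite divr_gt0//; lra.
apply: (le_trans (Hxy _ e10)); rewrite leeD2l// lee_fin mulrAC.
rewrite ler_pdivrMr; [nra|lra].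
Qed.

Lemma tube_upper K : compact K -> K `<=` eball p r ->
  (lebesgue_rV n.+1 (tube f V p K `[a, b]) <=
    (N a b * vol K - H a b * mom K)%:E)%E.
Proof.
move=> cK Kr; apply: (@vanishing_slope _ _ (b - a)) => [|e e0]; first by rewrite subr_ge0.
rewrite -EFinD.
pose P s t := (lebesgue_rV n.+1 (tube f V p K `[s, t]) <=
  (N s t * vol K - H s t * mom K + e * (t - s))%:E)%E.
have mT s t : a <= s -> t <= b -> measurable (tube f V p K `[s, t]).
  move=> as_ tb; apply: measurable_compact_rV; apply: compact_tube => //.
    exact: segment_compact.
  exact: sub_abJ.
apply: (@itv_local_ind R P a b ab) => [s m t as_ sm mt tb Psm Pmt|t0 t0ab].
  have sb : s <= b by rewrite (le_trans sm)// (le_trans mt).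
  have am : a <= m by rewrite (le_trans as_).
  have mb : m <= b by rewrite (le_trans mt).
  apply: (@le_trans _ _ (lebesgue_rV n.+1 (tube f V p K `[s, m] `|` tube f V p K `[m, t]))).
    apply: le_measure; rewrite ?inE//; [exact: mT|by apply: measurableU; exact: mT|].
    move=> _ [[x u] [/= Kx] + <-]; rewrite in_itv/= => /andP[su ut].
    have [um|/ltW mu_] := leP u m; [left|right]; exists (x, u) => //; split => //=;
      by rewrite in_itv/= ?su ?mu_.
  apply: (le_trans (measureU2 _ (mT _ _ as_ mb) (mT _ _ am tb))).
  apply: (le_trans (leeD Psm Pmt)); rewrite -EFinD lee_fin.
  by rewrite (N_add as_ sm mt tb) (H_add as_ sm mt tb); lra.
have e20 : 0 < e / 2 by rewrite divr_gt0.
have Jt0 : J t0 by apply: abJ; rewrite /= in_itv.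
have [d1 d10 h1] := tube_upper_local Jt0 cK Kr e20.
have [d2 d20 h2] := integral_local K t0ab e20.
exists (Num.min d1 d2) => [|s t as_ st0 t0t tb]; first by rewrite lt_min d10.
rewrite lt_min => /andP[ts1 ts2].
apply: (le_trans (h1 s t st0 t0t (sub_abJ as_ tb) ts1)); rewrite lee_fin.
by have := h2 s t as_ st0 t0t tb ts2; rewrite ler_norml => /andP[+ _]; lra.
Qed.

(** Half-open intervals make the pieces disjoint, by injectivity. *)
Lemma tube_lower A : open A -> A `<=` eball p r ->
  ((N a b * vol A - H a b * mom A)%:E <=
    lebesgue_rV n.+1 (tube f V p A `[a, b[))%E.
Proof.
move=> oA Ar; apply: (@vanishing_slope _ _ (b - a)) => [|e e0]; first by rewrite subr_ge0.
rewrite -leeBlDr// -EFinB.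
pose P s t := ((N s t * vol A - H s t * mom A - e * (t - s))%:E <=
  lebesgue_rV n.+1 (tube f V p A `[s, t[))%E.
have sub_coJ s t : a <= s -> t <= b -> `[s, t[ `<=` J.
  by move=> as_ tb; apply: subset_trans (sub_abJ as_ tb); exact: subset_itv_co_cc.
have mT s t : a <= s -> t <= b -> measurable (tube f V p A `[s, t[).
  by move=> as_ tb; apply: measurable_tube_open => //; exact: sub_coJ.
apply: (@itv_local_ind R P a b ab) => [s m t as_ sm mt tb Psm Pmt|t0 t0ab].
  have sb : s <= b by rewrite (le_trans sm)// (le_trans mt).
  have am : a <= m by rewrite (le_trans as_).
  have mb : m <= b by rewrite (le_trans mt).
  apply: (@le_trans _ _ (lebesgue_rV n.+1 (tube f V p A `[s, m[ `|` tube f V p A `[m, t[))).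
    rewrite measureU; [|exact: mT|exact: mT|].
      apply: le_trans (leeD Psm Pmt); rewrite -EFinD lee_fin.
      by rewrite (N_add as_ sm mt tb) (H_add as_ sm mt tb); lra.
    apply/seteqP; split => // _ [[[x u] [/= Ax um] <-] [[x' u'] [/= Ax' um'] E]].
    have := um; have := um'; rewrite !in_itv/= => /andP[mu' _] /andP[_ mu_].
    have : (x', u') = (x, u).
      apply: injG => //; rewrite inE; split => /=; [exact: Ar| |exact: Ar|].
        exact: (sub_coJ _ _ am tb).
      exact: (sub_coJ _ _ as_ mb).
    by move=> [_ uu]; move: mu_; rewrite -uu ltNge mu'.
  apply: le_measure; rewrite ?inE//; [by apply: measurableU; exact: mT|exact: mT|].
  move=> _ [] [[x u] [/= Ax]] + <-; rewrite in_itv/= => /andP[h1 h2];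
    exists (x, u) => //; split => //=; rewrite in_itv/=.
    by rewrite h1 (lt_le_trans h2).
  by rewrite (le_trans sm).
have e20 : 0 < e / 2 by rewrite divr_gt0.
have Jt0 : J t0 by apply: abJ; rewrite /= in_itv.
have [d1 d10 h1] := tube_lower_local Jt0 oA Ar e20.
have [d2 d20 h2] := integral_local A t0ab e20.
exists (Num.min d1 d2) => [|s t as_ st0 t0t tb]; first by rewrite lt_min d10.
rewrite lt_min => /andP[ts1 ts2].
apply: le_trans (h1 s t st0 t0t (sub_abJ as_ tb) ts1); rewrite lee_fin.
by have := h2 s t as_ st0 t0t tb ts2; rewrite ler_norml => /andP[_]; lra.
Qed.

(** The expected volume is the integral of [jac], which is nonnegative; this
    makes it monotone in the cross section. *)
Let flow_ge0 A : measurable A -> A `<=` eball p r ->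
  0 <= N a b * vol A - H a b * mom A.
Proof.
move=> mA Ar.
have integrableM (g : R -> R) (c : R) : {within `[a, b], continuous g} ->
    mu.-integrable `[a, b] (EFin \o (fun u => g u * c)).
  move=> cg; apply: continuous_compact_integrable; first exact: segment_compact.
  by move=> x; apply: cvgM; [exact: cg|exact: cvg_cst].
have inu : mu.-integrable `[a, b] (EFin \o nu).
  by apply: continuous_compact_integrable => //; exact: segment_compact.
have ith : mu.-integrable `[a, b] (EFin \o th).
  by apply: continuous_compact_integrable => //; exact: segment_compact.
rewrite /N /H -!RintegralZr// -RintegralB//; last 2 first.
- exact: integrableM.
- exact: integrableM.
apply: Rintegral_ge0 => u uab; have Ju := abJ uab.
rewrite -mulNr; apply: (affine_ge0 (r := r)) => // x Ax.
by rewrite mulNr; apply: jac_ge0 => //; exact: Ar.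
Qed.

(** The tube over [S] and the tubes over compact sets filling the complement of
    [S] in the ball obey the upper bound, and together they cover a set that
    obeys the lower bound. *)
Lemma tube_volume S : compact S -> S `<=` eball p r ->
  lebesgue_rV n.+1 (tube f V p S `[a, b]) = (N a b * vol S - H a b * mom S)%:E.
Proof.
move=> cS Sr; apply/eqP; rewrite eq_le tube_upper//=.
have clS : closed S by apply: compact_closed => //; exact: norm_hausdorff.
have mS := measurable_compact_rV cS; have mO := measurable_open_rV open_O.
have oD : open (eball p r `\` S) by apply: openI => //; rewrite openC.
have mD := measurable_open_rV oD.
have Dr : eball p r `\` S `<=` eball p r by move=> x [].
have [K [cK ndK DE]] := open_exhaustion oD.
have mK k := measurable_compact_rV (cK k).
have KD k : K k `<=` eball p r `\` S by rewrite DE; exact: bigcup_sup.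
have mT B : compact B -> measurable (tube f V p B `[a, b]).
  move=> cB; apply: measurable_compact_rV; apply: compact_tube => //.
  exact: segment_compact.
pose TK k := tube f V p (K k) `[a, b].
have mTK : measurable (\bigcup_k TK k).
  by apply: bigcupT_measurable => k; exact: mT.
have upperD : (lebesgue_rV n.+1 (\bigcup_k TK k) <=
    (N a b * vol (eball p r `\` S) - H a b * mom (eball p r `\` S))%:E)%E.
  have cv : lebesgue_rV n.+1 \o TK @ \oo --> lebesgue_rV n.+1 (\bigcup_k TK k).
    apply: nondecreasing_cvg_mu => // [k|k l kl]; first exact: mT.
    apply/subsetPset => _ [[x u] [/= Kx uab] <-]; exists (x, u) => //; split => //=.
    by have /subsetPset := ndK _ _ kl; apply.
  rewrite -(cvg_lim _ cv)//; apply: lime_le; first by apply/cvg_ex; eexists; exact: cv.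
  apply: nearW => k /=; apply: (le_trans (tube_upper (cK k) _)).
    exact: subset_trans (KD k) Dr.
  have mDK : measurable ((eball p r `\` S) `\` K k) by exact: measurableD.
  have DKr : (eball p r `\` S) `\` K k `<=` eball p r by move=> x [[]].
  have := flow_ge0 mDK DKr.
  have := volD (mK k) mD (KD k) Dr; have := momD i0 (mK k) mD (KD k) Dr.
  by rewrite lee_fin => -> ->; lra.
have low := tube_lower open_O (fun _ x => x).
have split_O : (lebesgue_rV n.+1 (tube f V p (eball p r) `[a, b[) <=
    lebesgue_rV n.+1 (tube f V p S `[a, b]) + lebesgue_rV n.+1 (\bigcup_k TK k))%E.
  apply: le_trans (measureU2 _ (mT _ cS) mTK); apply: le_measure; rewrite ?inE//.
  - by apply: measurable_tube_open => //;
      apply: subset_trans abJ; exact: subset_itv_co_cc.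
  - by apply: measurableU => //; exact: mT.
  move=> _ [[x u] [/= xr /subset_itv_co_cc uab] <-].
  have [Sx|Sx] := pselect (S x); [left|right]; first by exists (x, u).
  have : (eball p r `\` S) x by split.
  by rewrite DE => -[k _ Kx]; exists k => //; exists (x, u).
have vO := volD mS mO Sr (fun _ x => x); have kO := momD i0 mS mO Sr (fun _ x => x).
have := le_trans low (le_trans split_O (leeD2l _ upperD)).
rewrite -leeBlDr// -EFinB; apply: le_trans; rewrite lee_fin vO kO; lra.
Qed.

End frame.

(** * The Frenet frame and the barycenter *)

Section intervals_and_derivatives.
Context {R : realType}.

Lemma near_within_dnbhs_nbhs (J : set R) (t : R) (P : R -> Prop) :
  P t -> (\forall s \near within J t^', P s) -> \forall s \near within J (nbhs t), P s.
Proof.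
move=> Pt H; suff : nbhs t (fun s => J s -> P s) by [].
have F : nbhs t (fun s => s != t -> J s -> P s) by exact: H.
apply: filterS F => s h Js; have [->//|st] := eqVneq s t; exact: h.
Qed.

Lemma continuous_within_of_derivable (W : normedModType R) (J : set R)
    (g : R -> W) (t : R) :
  cvg ((s - t)^-1 *: (g s - g t) @[s --> within J t^']) ->
  g s @[s --> within J (nbhs t)] --> g t.
Proof.
move=> /cvg_ex[l ql].
have c0 : s - t @[s --> within J t^'] --> (0 : R).
  rewrite -(subrr t); apply: cvgB; last exact: cvg_cst.
  by apply: cvg_within_dnbhs; exact: cvg_within.
have cz : (s - t) *: ((s - t)^-1 *: (g s - g t)) @[s --> within J t^'] --> (0 : W).
  by rewrite -(scale0r l); apply: cvgZ.
have /cvgrPdist_lt H := cz.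
apply/cvgrPdist_lt => e e0; apply: near_within_dnbhs_nbhs; first by rewrite subrr normr0.
have := H e e0; rewrite !near_withinE.
apply: filterS2 (nbhs_dnbhs_neq t) => s st h Js.
have := h Js; rewrite sub0r normrN scalerA divff ?subr_eq0// scale1r.
by rewrite distrC.
Qed.

(** One-sided derivatives at the ends of [J] are limits along [J], so every
    point of [J] must be approached by others. *)
Lemma interval_accumulation (J : set R) (t d : R) :
  is_interval J -> J° !=set0 -> J t -> 0 < d ->
  exists t', [/\ J t', t' != t & `|t' - t| < d].
Proof.
move=> iJ [c /nbhs_ballP[e /= e0 cJ]] Jt d0.
have [t1 Jt1 tt1] : exists2 t1, J t1 & t1 != t.
  have [ct|ct] := eqVneq c t; last by exists c => //; apply: cJ; exact: ballxx.
  have e20 : 0 < e / 2 by rewrite divr_gt0.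
  exists (c + e / 2).
    apply: cJ; rewrite -ball_normE /= opprD addrA subrr add0r normrN gtr0_norm//.
    by rewrite ltr_pdivrMr// mulr_natr mulr2n ltrDl.
  by rewrite -ct -subr_eq0 addrAC subrr add0r gt_eqF.
have d20 : 0 < d / 2 by rewrite divr_gt0.
have dd : d / 2 < d by rewrite ltr_pdivrMr// mulr_natr mulr2n ltrDl.
have [lt|lt] := ltP t t1.
  have m : t < Num.min t1 (t + d / 2) by rewrite lt_min lt ltrDl.
  exists (Num.min t1 (t + d / 2)); split; last 2 first.
  - by rewrite gt_eqF.
  - rewrite gtr0_norm ?subr_gt0// (le_lt_trans _ dd)// lerBlDl.
    by rewrite ge_min lexx orbT.
  by apply: (iJ t t1) => //; rewrite (ltW m) ge_min lexx.
have {}lt : t1 < t by rewrite lt_neqAle tt1.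
have m : Num.max t1 (t - d / 2) < t by rewrite gt_max lt ltrBlDr ltrDl.
exists (Num.max t1 (t - d / 2)); split; last 2 first.
- by rewrite lt_eqF.
- rewrite ltr0_norm ?subr_lt0// opprB (le_lt_trans _ dd)// lerBlDr addrC -lerBlDr.
  by rewrite le_max lexx orbT.
by apply: (iJ t1 t) => //; rewrite (ltW m) le_max lexx.
Qed.

Lemma continuous_within_sub (U : topologicalType) (J I : set R) (g : R -> U) :
  I `<=` J -> (forall t, J t -> g s @[s --> within J (nbhs t)] --> g t) ->
  {within I, continuous g}.
Proof.
move=> IJ cg; apply/subspace_continuousP => t It.
move=> A /(cg t (IJ _ It)) nA; suff : nbhs t (fun s => I s -> A (g s)) by [].
have F : nbhs t (fun s => J s -> A (g s)) by exact: nA.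
by apply: filterS F => s h Is; apply: h; exact: IJ.
Qed.

End intervals_and_derivatives.

Lemma mom_barycenter (R : realType) (n : nat) (i0 : 'I_n) (S : set 'rV[R]_n) (r : R) :
  measurable S -> S `<=` eball (barycenter S) r -> (0 < lebesgue_rV n S)%E ->
  mom i0 (barycenter S) S = 0.
Proof.
move=> mS Sr S0; set p := barycenter S.
have vS : 0 < vol S by rewrite -lte_fin -(volE mS Sr).
have := integral_affine i0 (p 0 i0) 1 mS Sr; rewrite -/p.
under eq_integral do rewrite mul1r addrC subrK.
move=> /(congr1 fine); rewrite -[LHS]/(\int[lebesgue_rV n]_(x in S) x 0 i0) /= mul1r.
have -> : \int[lebesgue_rV n]_(x in S) x 0 i0 = p 0 i0 * vol S.
  by rewrite /p mxE -/(vol S) mulrC mulrA divff ?mul1r ?gt_eqF.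
by move=> /eqP; rewrite -subr_eq0 opprD addrA subrr sub0r oppr_eq0 => /eqP.
Qed.

Theorem theorem6p9 (R : realType) (n : nat) (J : set R)
    (f : R -> 'rV[R]_n.+1) (kappa : nat -> R -> R)
    (V : nat -> R -> 'rV[R]_n.+1) (a b r : R) (S : set 'rV[R]_n) :
  (0 < n)%N ->
  is_interval J -> J° !=set0 ->
  regular_curve J f ->
  frenet_apparatus J f kappa V ->
  a <= b -> `[a, b] `<=` J ->
  compact S -> (0 < lebesgue_rV n S)%E ->
  let p := barycenter S in
  0 < r -> (r%:E < frenet_radius J kappa)%E ->
  S `<=` eball p r ->
  set_inj (eball p r `*` J) (tube_map f V p) ->
  (lebesgue_rV n.+1 (tube f V p S `[a, b]) =
   arc_length J f a b * lebesgue_rV n S)%E.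
Proof.
move=> n0 iJ J0 [smf nu0] [[smV orthV] V1 frenet _] ab abJ cS S0 p r0 _ Sr injG.
pose i0 := Ordinal n0.
pose th t := dotv (derive_on J (V 1) t) (V 2 t).
have i1 : (1 <= 1 <= n.+1)%N by [].
have orthW t : J t -> frame_mx V n.+1 t *m (frame_mx V n.+1 t)^T = 1%:M.
  move=> Jt; apply/matrixP => i j; rewrite -dotv_row mxE.
  have rowE k : row k (frame_mx V n.+1 t) = V k.+1 t.
    by apply/rowP => l; rewrite !mxE.
  by rewrite !rowE orthV//; apply/andP; split => //; exact: ltn_ord.
have contf t0 : J t0 -> f t @[t --> within J (nbhs t0)] --> f t0.
  by move=> Jt0; apply: continuous_within_of_derivable; exact: (smf 0%N t0 Jt0).
have contV t0 j : J t0 -> (1 <= j <= n.+1)%N ->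
    V j t @[t --> within J (nbhs t0)] --> V j t0.
  move=> Jt0 jn; apply: continuous_within_of_derivable.
  exact: (smV j jn 0%N t0 Jt0).
have derf t0 : J t0 -> (t - t0)^-1 *: (f t - f t0) @[t --> within J t0^'] -->
    speed J f t0 *: V 1 t0.
  move=> Jt0; rewrite V1// scalerA divff ?gt_eqF ?nu0// scale1r.
  exact: (smf 0%N t0 Jt0).
have derV t0 : J t0 -> (t - t0)^-1 *: (V 1 t - V 1 t0) @[t --> within J t0^'] -->
    th t0 *: V 2 t0.
  move=> Jt0; have -> : th t0 *: V 2 t0 = derive_on J (V 1) t0.
    have [eV _ _] := frenet t0 Jt0.
    by rewrite /th eV dotvZl orthV// eqxx mulr1.
  exact: (smV 1%N i1 0%N t0 Jt0).
have accJ t d := @interval_accumulation R J t d iJ J0.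
have contf' t0 : J t0 ->
    derive_on J f t @[t --> within J (nbhs t0)] --> derive_on J f t0.
  by move=> Jt0; apply: continuous_within_of_derivable; exact: (smf 1%N t0 Jt0).
have contV1' t0 : J t0 ->
    derive_on J (V 1) t @[t --> within J (nbhs t0)] --> derive_on J (V 1) t0.
  move=> Jt0; apply: continuous_within_of_derivable.
  exact: (smV 1%N i1 1%N t0 Jt0).
have contnu : {within `[a, b], continuous (speed J f)}.
  apply: (continuous_within_sub abJ) => t Jt.
  by apply: (cvg_comp _ _ (contf' t Jt)); exact: enorm_continuous.
have contth : {within `[a, b], continuous th}.
  apply: (continuous_within_sub abJ) => t Jt.
  by apply: cvg_dotv; [exact: contV1'|exact: contV].
have mS := measurable_compact_rV cS.
rewrite (tube_volume (i0 := i0) (nu := speed J f) (th := th) orthW contf contV derf derV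
  nu0 accJ injG r0 ab abJ contnu contth cS Sr).
rewrite (mom_barycenter i0 mS Sr S0) mulr0 subr0 EFinM (volE mS Sr); congr (_ * _)%E.
rewrite /arc_length fineK//; apply: integrable_fin_num => //.
by apply: continuous_compact_integrable => //; exact: segment_compact.
Qed.
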